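(* Let $I \subseteq R=\Bbbk[x_1,\dots,x_n]$ be a monomial ideal. Then $$\ell_s(I) = \mathrm{mdc}(\mathrm{SP}(I)) + 1.$$
   Context: $\Bbbk$ is a field, $R = \Bbbk[x_1,\dots,x_n]$, $\mathfrak{m} = (x_1,\dots,x_n)$. For $\mathbf{a} \in \mathbb{Z}^n_{\ge 0}$, $x^{\mathbf a} = x_1^{a_1}\cdots x_n^{a_n}$. $\mathrm{Ass}(I)$ denotes the set of associated primes of $I$ (i.e. of $R/I$), and $\mathrm{maxAss}(I)$ its maximal elements under inclusion. The $k$-th symbolic power of $I$ is $I^{(k)} = \bigcap_{\mathfrak{p} \in \mathrm{Ass}(I)} (I^k R_{\mathfrak{p}} \cap R)$ for $k\ge 1$, and $I^{(0)} = R$. The symbolic Rees algebra is $\mathcal{R}_s(I) = \bigoplus_{k\ge 0} I^{(k)}t^k \subseteq R[t]$, and the symbolic analytic spread is $\ell_s(I) = \dim (\mathcal{R}_s(I)/\mathfrak{m}\mathcal{R}_s(I))$. The Newton polyhedron $\mathrm{NP}(I)$ of a monomial ideal $I$ is the convex hull in $\mathbb{R}^n$ of $\{\mathbf{a} \in \mathbb{Z}^n_{\ge 0} : x^{\mathbf{a}} \in I\}$ (so $\mathrm{NP}(0) = \emptyset$). The symbolic polyhedron of $I$ is $\mathrm{SP}(I) = \bigcap_{\mathfrak{p} \in \mathrm{maxAss}(I)} \mathrm{NP}(R \cap I R_{\mathfrak{p}})$. For $I = R$, where these intersections are empty, they are read as $I^{(k)}=R$ and $\mathrm{SP}(I) =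 \mathbb{R}^n_{\ge 0}$. For a polyhedron $P$, $\mathrm{mdc}(P)$ is the maximum dimension of a compact face of $P$ (with $\mathrm{mdc}(\emptyset)=-1$). *)

(* Defs.v *)
From HB Require Import structures.
From mathcomp Require Import all_boot all_order all_algebra.
From mathcomp Require Import mpoly.
From mathcomp Require Import mathcomp_extra boolp classical_sets functions.
From mathcomp Require Import reals ereal topology normedtype convex.

Set Implicit Arguments.
Unset Strict Implicit.
Unset Printing Implicit Defensive.

Import Order.TTheory GRing.Theory Num.Theory.
Import numFieldTopology.Exports.

Local Open Scope classical_set_scope.
Local Open Scope ring_scope.

Section Ideals.
Variable A : comNzRingType.
Implicit Types (B S I : set A).

Definition lin_span B S : set A :=
  [set x | exists2 s : seq (A * A),
     {in s, forall q, B q.1 /\ S q.2} & x = \sum_(q <- s) q.1 * q.2].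

Definition ideal_gen S : set A := lin_span setT S.

Definition ideal_pow I (k : nat) : set A :=
  ideal_gen [set \prod_(i < k) f i | f in [set f : 'I_k -> A | forall i, I (f i)]].

Lemma lin_span0 B S : lin_span B S 0.
Proof. by exists [::]; rewrite ?big_nil. Qed.

Lemma lin_spanD B S x y : lin_span B S x -> lin_span B S y -> lin_span B S (x + y).
Proof.
move=> [s hs ->] [t ht ->]; exists (s ++ t); last by rewrite big_cat.
by move=> q; rewrite mem_cat => /orP[/hs|/ht].
Qed.

Lemma lin_spanM B S C T U V x y :
    (forall b c, B b -> C c -> U (b * c)) ->
    (forall s t, S s -> T t -> lin_span U V (s * t)) ->
    (forall u v, U u -> U v -> U (u * v)) ->
  lin_span B S x -> lin_span C T y -> lin_span U V (x * y).
Proof.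
move=> BCU STV UM [s hs ->] [t ht ->].
have ZU u z : U u -> lin_span U V z -> lin_span U V (u * z).
  move=> Uu [r hr ->]; exists [seq (u * q.1, q.2) | q <- r].
    by move=> _ /mapP[q /hr[Uq Vq] ->]; split=> //; apply: UM.
  by rewrite big_map mulr_sumr; apply: eq_bigr => q _; rewrite mulrA.
rewrite mulr_suml big_seq.
elim/big_ind: _ => [|u v|p /hs[Bp Sp]]; [exact: lin_span0|exact: lin_spanD|].
rewrite mulr_sumr big_seq.
elim/big_ind: _ => [|u v|q /ht[Cq Tq]]; [exact: lin_span0|exact: lin_spanD|].
by rewrite mulrACA; apply: ZU; [apply: BCU|apply: STV].
Qed.

Lemma ideal_genP S s : S s -> ideal_gen S s.
Proof.
move=> Ss; exists [:: (1, s)]; last by rewrite big_seq1 mul1r.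
by move=> q; rewrite inE => /eqP->.
Qed.

Lemma ideal_genMl S a x : ideal_gen S x -> ideal_gen S (a * x).
Proof.
move=> [r hr ->]; exists [seq (a * q.1, q.2) | q <- r].
  by move=> _ /mapP[q /hr[Uq Vq] ->]; split.
by rewrite big_map mulr_sumr; apply: eq_bigr => q _; rewrite mulrA.
Qed.

Lemma ideal_powM I k l x y :
  ideal_pow I k x -> ideal_pow I l y -> ideal_pow I (k + l) (x * y).
Proof.
apply: lin_spanM => // _ _ [f If <-] [g Ig <-]; apply: ideal_genP.
exists (fun i : 'I_(k + l) => match fintype.split i with inl j => f j | inr j => g j end).
  by move=> i; case: (fintype.split i).
rewrite big_split_ord; congr (_ * _); apply: eq_bigr => i _.
  by rewrite (unsplitK (inl i)).
by rewrite (unsplitK (inr i)).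
Qed.

End Ideals.

Section SymbolicPowers.
Variable A : idomainType.
Implicit Types (I : set A) (p : prime_idealr A).

(* The localization of A at p, inside the fraction field of A. *)
Definition localization p : set {fraction A} :=
  [set z | exists a s : A, s \notin p /\ z = tofrac a / tofrac s].

(* A `&` I A_p: the contraction of the extension of I to A_p. *)
Definition loc_contraction I p : set A :=
  @tofrac A @^-1` lin_span (localization p) (@tofrac A @` I).

Definition Ass I : set (prime_idealr A) :=
  [set p | exists f : A, forall g : A, g \in p <-> I (g * f)].

Definition maxAss I : set (prime_idealr A) :=
  [set p | Ass I p /\ forall q : prime_idealr A,
     Ass I q -> {subset p <= q} -> {subset q <= p}].

Definition symbolic_power I (k : nat) : set A :=
  if k is 0 then setT
  else \bigcap_(p in Ass I) loc_contraction (ideal_pow I k) p.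

Lemma localizationM p z w :
  localization p z -> localization p w -> localization p (z * w).
Proof.
move=> [a [s [ps ->]]] [b [t [pt ->]]]; exists (a * b), (s * t); split.
  by rewrite prime_idealrM negb_or ps.
by rewrite !rmorphM invfM mulrACA.
Qed.

Lemma localization_frac p a : localization p (tofrac a).
Proof. by exists a, 1; rewrite idealr1 rmorph1 divr1. Qed.

Lemma symbolic_power0 I k : symbolic_power I k 0.
Proof.
by case: k => // k p _; rewrite /loc_contraction /= rmorph0; apply: lin_span0.
Qed.

Lemma symbolic_powerD I k x y :
  symbolic_power I k x -> symbolic_power I k y -> symbolic_power I k (x + y).
Proof.
case: k => // k hx hy p Ip; rewrite /loc_contraction /= rmorphD.
by apply: lin_spanD; [apply: hx|apply: hy].
Qed.

Lemma symbolic_powerMl I k a x :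
  symbolic_power I k x -> symbolic_power I k (a * x).
Proof.
case: k => // k hx p Ip; have [r hr e] := hx p Ip.
rewrite /loc_contraction /= (rmorphM (@tofrac A)) /= e.
exists [seq (tofrac a * q.1, q.2) | q <- r].
  move=> _ /mapP[q /hr[Uq Vq] ->]; split=> //.
  by apply: localizationM => //; apply: localization_frac.
by rewrite big_map mulr_sumr; apply: eq_bigr => q _; rewrite mulrA.
Qed.

Lemma symbolic_powerM I k l x y : symbolic_power I k x ->
  symbolic_power I l y -> symbolic_power I (k + l) (x * y).
Proof.
case: k => [_ hy|k]; first exact: symbolic_powerMl.
case: l => [hx _|l hx hy p Ip].
  by rewrite addn0 mulrC; apply: symbolic_powerMl.
rewrite /loc_contraction /= (rmorphM (@tofrac A)) /=.
apply: lin_spanM (hx p Ip) (hy p Ip); try exact: localizationM.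
move=> _ _ [s Is <-] [t It <-]; exists [:: (1, tofrac (s * t))].
  move=> q; rewrite inE => /eqP-> /=; split.
    by rewrite -(rmorph1 (@tofrac A)); apply: localization_frac.
  by exists (s * t) => //; apply: (ideal_powM Is It).
by rewrite big_seq1 mul1r rmorphM.
Qed.

(* The Rees algebra is realized inside A[t], t being the variable of
   [{poly A}]. *)
Definition in_symbolic_Rees I : {pred {poly A}} :=
  fun F => `[< forall k, symbolic_power I k F`_k >].

Lemma in_symbolic_Rees_subring I : subring_closed (in_symbolic_Rees I).
Proof.
have sgN k x : symbolic_power I k x -> symbolic_power I k (- x).
  by rewrite -mulN1r; apply: symbolic_powerMl.
split.
- apply/asboolP => -[|k] //; rewrite coef1; exact: symbolic_power0.
- move=> F G /asboolP hF /asboolP hG; apply/asboolP => k.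
  by rewrite coefB; apply: symbolic_powerD => //; apply: sgN.
- move=> F G /asboolP hF /asboolP hG; apply/asboolP => k; rewrite coefM.
  elim/big_ind: _ => [|x y|i _].
  + exact: symbolic_power0.
  + exact: symbolic_powerD.
  by rewrite -[X in symbolic_power I X](subnKC (leq_ord i));
     apply: symbolic_powerM.
Qed.

HB.instance Definition _ I := GRing.isSubringClosed.Build {poly A}
  (in_symbolic_Rees I) (in_symbolic_Rees_subring I).

Record symbolic_Rees I := SymbolicRees {
  Rees_poly : {poly A};
  _ : Rees_poly \in in_symbolic_Rees I }.

HB.instance Definition _ I := [isSub for @Rees_poly I].
HB.instance Definition _ I := [Choice of symbolic_Rees I by <:].
HB.instance Definition _ I :=
  [SubChoice_isSubComNzRing of symbolic_Rees I by <:].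

End SymbolicPowers.

(* Krull dimension, valued in the extended reals so that it is total and can
   be compared with dimensions of polyhedra: the supremum of the lengths of
   chains c 0 < c 1 < .. < c m of prime ideals. *)
Definition krull_dim (R : realType) (A : comNzRingType) : \bar R :=
  ereal_sup [set (m%:R)%:E | m in [set m : nat |
    exists c : nat -> prime_idealr A, forall i, (i < m)%N ->
      {subset c i <= c i.+1} /\ ~ {subset c i.+1 <= c i}]].

Section SymbolicAnalyticSpread.
Variables (k : fieldType) (n : nat).
Implicit Types I : set {mpoly k[n]}.

Definition monomial_ideal I : Prop :=
  exists M : set 'X_{1..n}, I = ideal_gen [set 'X_[m] | m in M].

Definition irrelevant_ideal : set {mpoly k[n]} :=
  ideal_gen [set 'X_i | i in [set: 'I_n]].

(* The extension of the irrelevant ideal to the symbolic Rees algebra. *)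
Definition fiber_ideal I : set (symbolic_Rees I) :=
  ideal_gen [set F | exists2 f, irrelevant_ideal f & Rees_poly F = f%:P].

Definition in_fiber_ideal I : {pred symbolic_Rees I} :=
  fun F => `[< fiber_ideal F >].

Lemma fiber_ideal_coef I (F : symbolic_Rees I) :
  fiber_ideal F -> ((Rees_poly F)`_0)@_0%MM = 0.
Proof.
have cM (x y : {mpoly k[n]}) : (x * y)@_0%MM = x@_0%MM * y@_0%MM.
  exact: (rmorphM (mcoeff 0%MM)).
move=> [s hs ->]; rewrite big_seq.
elim/big_ind: _ => [|x y hx hy|q /hs[_ [f [r hr ->] e]]].
- by rewrite coef0 mcoeff0.
- by rewrite coefD mcoeffD hx hy addr0.
have -> : Rees_poly (q.1 * q.2) = Rees_poly q.1 * Rees_poly q.2 by [].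
rewrite e coefM big_ord1 coefC /= cM raddf_sum big_seq big1 ?mulr0 //.
move=> z /hr[_ [i _ zi]].
by apply: (etrans (cM z.1 z.2)); rewrite -zi mcoeffX mnm1_eq0 mulr0.
Qed.

Lemma in_fiber_ideal_closed I : idealr_closed (@in_fiber_ideal I).
Proof.
split.
- by apply/asboolP; apply: lin_span0.
- apply/asboolP => /fiber_ideal_coef.
  have -> : Rees_poly (1 : symbolic_Rees I) = 1 by [].
  by rewrite coef1 mcoeff1 eqxx => /eqP; rewrite oner_eq0.
- move=> a u v /asboolP hu /asboolP hv; apply/asboolP.
  by apply: lin_spanD => //; apply: ideal_genMl.
Qed.

HB.instance Definition _ I := isIdealr.Build (symbolic_Rees I)
  (@in_fiber_ideal I) (in_fiber_ideal_closed I).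

Definition symbolic_fiber I : comNzRingType :=
  {ideal_quot (@in_fiber_ideal I : idealr (symbolic_Rees I))}.

Definition symbolic_analytic_spread (R : realType) I : \bar R :=
  krull_dim R (symbolic_fiber I).

End SymbolicAnalyticSpread.

Arguments symbolic_analytic_spread {k n} R I.

Section Polyhedra.
Variables (R : realType) (n : nat).
Implicit Types (P F : set 'rV[R]_n).

Definition aff_indep m (x : 'I_m -> 'rV[R]_n) : Prop :=
  forall w : 'I_m -> R, \sum_i w i = 0 -> \sum_i w i *: x i = 0 ->
    forall i, w i = 0.

(* Dimension of the affine hull; the dimension of the empty set is -1. *)
Definition aff_dim F : \bar R :=
  ereal_sup [set (m%:R - 1)%:E | m in [set m : nat |
    exists x : 'I_m -> 'rV[R]_n, (forall i, F (x i)) /\ aff_indep x]].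

(* c = 0 is allowed: P and the empty set are faces of P. *)
Definition face P F : Prop :=
  exists (c : 'rV[R]_n) (b : R),
    (forall v, P v -> b <= \sum_i c 0 i * v 0 i) /\
    F = [set v | P v /\ \sum_i c 0 i * v 0 i = b].

Definition mdc P : \bar R :=
  ereal_sup [set aff_dim F | F in [set F | face P F /\ compact F]].

End Polyhedra.

Section SymbolicPolyhedron.
Variables (R : realType) (k : fieldType) (n : nat).
Implicit Types I : set {mpoly k[n]}.

Definition Newton_polyhedron I : set 'rV[R]_n :=
  smallest (@convex_set R 'rV[R]_n)
    [set \row_i (m i)%:R | m in [set m : 'X_{1..n} | I 'X_[m]]].

(* Newton polyhedra lie in the nonnegative orthant, so intersecting with it
   only matters when [maxAss I] is empty, that is when I is the unit ideal. *)
Definition symbolic_polyhedron I : set 'rV[R]_n :=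
  [set v : 'rV[R]_n | forall i, 0 <= v 0 i] `&`
  \bigcap_(p in maxAss I) Newton_polyhedron (loc_contraction I p).

End SymbolicPolyhedron.

Arguments Newton_polyhedron R {k n} I _.
Arguments symbolic_polyhedron R {k n} I _.

(* Main.v *)
(* Let S be the monoid of the (a, m) such that x^a lies in I^(m), so that the
   symbolic Rees algebra is the monoid algebra k[S]. Then S is a finite
   intersection of monoids attached to the Newton polyhedra defining SP(I), and
   the cone spanned by S is the cone over SP(I); compact faces of SP(I)
   correspond to the faces F of S containing no (e_i, 0).

   Given such a face F and m linearly independent elements of F, project F onto
   m coordinates on which it keeps rank m, and set the corresponding variables
   to 1 one after the other: the kernels of the resulting maps
   k[S] -> k[F] -> k[y_1, .., y_m] form a chain of m + 1 primes containing the
   variables.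

   Conversely, let c_0 < .. < c_m be primes of k[S] containing the variables.
   The monomials outside c_0 form such a face F, and k[S] / c_0 is a quotient of
   k[F], which embeds in a polynomial ring in r = rank F variables. Elements
   f_i of c_(i+1) \ c_i are algebraically independent modulo c_0, so m <= r. *)
Require Import Defs.
From HB Require Import structures.
From mathcomp Require Import all_boot all_order all_algebra.
From mathcomp Require Import mpoly.
From mathcomp Require Import boolp classical_sets functions.
From mathcomp Require Import reals ereal interval_inference topology normedtype convex.
From mathcomp Require Import lra zify.

Set Implicit Arguments.
Unset Strict Implicit.
Unset Printing Implicit Defensive.

Import Order.TTheory GRing.Theory Num.Theory.
Import numFieldNormedType.Exports.

Local Open Scope classical_set_scope.
Local Open Scope ring_scope.
Local Open Scope quotient_scope.

(** * Convex cones *)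

(** Finite generation comes from Dickson's lemma, applied to each Newton polyhedron separately. The
    pieces are glued by integrality: for monoids of integer vectors, the cone of an intersection is
    the intersection of the cones, since Fourier-Motzkin elimination uses integer weights there. The
    same fact gives every lattice point of the real cone over S a positive multiple in S.

    A nonempty face of SP(I) cut out by c.v = b is compact exactly when every c_i is positive,
    because SP(I) is closed under adding multiples of e_i. A face F of S, however, is only known to
    avoid each (e_i, 0). Producing from this a functional that supports F and is positive on all
    (e_i, 0) at once is the delicate point; it is done by Farkas' lemma, one variable at a time, and
    by summation.

    The passage from Ass to maxAss rests on two facts: associated primes of monomial ideals are
    generated by variables, and a localization of a monomial ideal only depends on the variables in
    the prime. Smaller associated primes then impose weaker conditions. *)

Section Cones.
Variables (R : realFieldType) (V : lmodType R).
Implicit Types (Y : set V) (v : V).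

Definition cone Y : set V := [set v | exists2 s : seq (R * V),
  (forall q, q \in s -> 0 <= q.1 /\ Y q.2) & v = \sum_(q <- s) q.1 *: q.2].

Lemma cone0 Y : cone Y 0.
Proof. by exists [::]; rewrite ?big_nil. Qed.

Lemma coneD Y u v : cone Y u -> cone Y v -> cone Y (u + v).
Proof.
move=> [s hs ->] [t ht ->]; exists (s ++ t); last by rewrite big_cat.
by move=> q; rewrite mem_cat => /orP[/hs|/ht].
Qed.

Lemma coneZ Y a v : 0 <= a -> cone Y v -> cone Y (a *: v).
Proof.
move=> a0 [s hs ->]; exists [seq (a * q.1, q.2) | q <- s].
  by move=> _ /mapP[q /hs[q0 Yq] ->]; split=> //=; apply: mulr_ge0.
by rewrite big_map scaler_sumr; apply: eq_bigr => q _; rewrite scalerA.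
Qed.

Lemma cone_sub Y v : Y v -> cone Y v.
Proof.
move=> Yv; exists [:: (1, v)]; last by rewrite big_seq1 scale1r.
by move=> q; rewrite inE => /eqP->.
Qed.

Lemma cone_sum Y (J : eqType) (r : seq J) (P : pred J) (F : J -> V) :
  (forall j, j \in r -> P j -> cone Y (F j)) -> cone Y (\sum_(j <- r | P j) F j).
Proof.
move=> h; rewrite big_seq_cond; apply: big_ind => [||j /andP[jr Pj]].
- exact: cone0.
- by move=> *; apply: coneD.
exact: h.
Qed.

Lemma cone_min Y (Q : set V) :
    Q 0 -> (forall u v, Q u -> Q v -> Q (u + v)) ->
    (forall a v, 0 <= a -> Q v -> Q (a *: v)) -> Y `<=` Q ->
  cone Y `<=` Q.
Proof.
move=> Q0 QD QZ YQ v [s hs ->]; rewrite big_seq; elim/big_ind: _ => // q.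
by move=> /hs[q0 /YQ]; apply: QZ.
Qed.

Lemma cone_idem Y Z : Y `<=` cone Z -> cone Y `<=` cone Z.
Proof.
by move=> h; apply: cone_min h; [apply: cone0|exact: coneD|exact: coneZ].
Qed.

Lemma cone_mono Y Z : Y `<=` Z -> cone Y `<=` cone Z.
Proof. by move=> h; apply: cone_idem => v /h; apply: cone_sub. Qed.

(* Fourier-Motzkin elimination: the terms on which [f] is positive are paired
   with those on which it is negative, with weights cancelling [f]. *)
Lemma cone_hyperplane Y (f : {linear V -> R^o}) v :
    Y 0 -> (forall x y, Y x -> Y y -> Y (x + y)) ->
    (forall y, Y y -> exists z : int, f y = z%:~R) ->
  cone Y v -> f v = 0 -> cone [set y | Y y /\ f y = 0] v.
Proof.
move=> Y0 YD Yint [s hs ->].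
have Yn m y : Y y -> Y (m%:R *: y).
  move=> Yy; elim: m => [|m IH]; first by rewrite scale0r.
  by rewrite -addn1 natrD scalerDl scale1r; apply: YD.
rewrite linear_sum => fv0.
pose T := \sum_(q <- s | 0 < f q.2) q.1 * f q.2.
have TE : T = \sum_(q <- s | f q.2 < 0) q.1 * - f q.2.
  apply/eqP; rewrite -subr_eq0 -sumrN.
  have -> : \sum_(q <- s | f q.2 < 0) - (q.1 * - f q.2)
     = \sum_(q <- s | ~~ (0 < f q.2)) q.1 * f q.2.
    rewrite [RHS](bigID (fun q => f q.2 < 0)) /= [X in _ = _ + X]big1 ?addr0.
      apply: eq_big => [q|q _]; last by rewrite mulrN opprK.
      by case: ltgtP.
    by move=> q; rewrite -!leNgt => /le_anti->; rewrite mulr0.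
  rewrite /T -(bigID (fun q => 0 < f q.2) xpredT) /=; apply/eqP; rewrite -[RHS]fv0.
  by apply: eq_bigr => q _; rewrite linearZ.
have ge0 q : q \in s -> 0 <= q.1 by move=> /hs[].
have split3 : \sum_(q <- s) q.1 *: q.2 = \sum_(q <- s | f q.2 == 0) q.1 *: q.2 +
   (\sum_(q <- s | 0 < f q.2) q.1 *: q.2 + \sum_(q <- s | f q.2 < 0) q.1 *: q.2).
  rewrite (bigID (fun q => f q.2 == 0)) /=; congr (_ + _).
  rewrite (bigID (fun q => 0 < f q.2)) /=.
  by congr (_ + _); apply: eq_bigl => q; case: ltgtP.
have T0 : 0 <= T.
  rewrite /T big_seq_cond; apply: sumr_ge0 => q /andP[/ge0 q0 /ltW].
  exact: mulr_ge0.
have c0 : cone [set y | Y y /\ f y = 0] (\sum_(q <- s | f q.2 == 0) q.1 *: q.2).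
  apply: cone_sum => q /hs[q0 Yq] /eqP fq; apply: coneZ => //.
  exact: cone_sub.
rewrite split3; apply: coneD => //.
have [T0'|T0'] := eqVneq T 0.
  have z1 : \sum_(q <- s | 0 < f q.2) q.1 *: q.2 = 0.
    rewrite big_seq_cond big1 // => q /andP[qs fq].
    suff -> : q.1 = 0 by rewrite scale0r.
    have /eqP := T0'; rewrite /T big_seq_cond psumr_eq0; last first.
      by move=> q' /andP[/ge0 ? /ltW ?]; apply: mulr_ge0.
    move=> /allP/(_ _ qs); rewrite qs fq /= mulf_eq0 => /orP[/eqP//|].
    by rewrite gt_eqF.
  have z2 : \sum_(q <- s | f q.2 < 0) q.1 *: q.2 = 0.
    rewrite big_seq_cond big1 // => q /andP[qs fq].
    suff -> : q.1 = 0 by rewrite scale0r.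
    have /eqP := T0'; rewrite TE big_seq_cond psumr_eq0; last first.
      by move=> q' /andP[/ge0 ? /ltW ?]; apply: mulr_ge0; rewrite ?oppr_ge0.
    move=> /allP/(_ _ qs); rewrite qs fq /= mulf_eq0 => /orP[/eqP//|].
    by rewrite oppr_eq0 lt_eqF.
  by rewrite z1 z2 addr0; apply: cone0.
have fE q : \sum_(r <- s | f r.2 < 0) (q.1 * r.1 / T * - f r.2) *: q.2 =
    q.1 *: q.2.
  rewrite -scaler_suml; congr (_ *: _).
  transitivity (\sum_(r <- s | f r.2 < 0) (q.1 / T) * (r.1 * - f r.2)).
    by apply: eq_bigr => r _; lra.
  by rewrite -mulr_sumr -TE -mulrA mulVf ?mulr1.
have -> : \sum_(q <- s | 0 < f q.2) q.1 *: q.2 +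
          \sum_(q <- s | f q.2 < 0) q.1 *: q.2 =
    \sum_(q <- s | 0 < f q.2) \sum_(r <- s | f r.2 < 0)
       ((q.1 * r.1) / T) *: ((- f r.2) *: q.2 + f q.2 *: r.2).
  transitivity (\sum_(q <- s | 0 < f q.2) (q.1 *: q.2 +
      \sum_(r <- s | f r.2 < 0) (q.1 * r.1 / T * f q.2) *: r.2)); last first.
    apply: eq_bigr => q _; rewrite -[in X in X + _]fE -big_split /=.
    by apply: eq_bigr => r _; rewrite scalerDr !scalerA.
  rewrite big_split /=; congr (_ + _); rewrite exchange_big /=.
  apply/esym; apply: eq_bigr => r _; rewrite -scaler_suml; congr (_ *: _).
  transitivity (\sum_(q <- s | 0 < f q.2) (r.1 / T) * (q.1 * f q.2)).
    by apply: eq_bigr => q _; lra.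
  by rewrite -mulr_sumr -/T -mulrA mulVf ?mulr1.
apply: cone_sum => q /hs[q0 Yq] fq; apply: cone_sum => r /hs[r0 Yr] fr.
apply: coneZ; first by rewrite divr_ge0 ?mulr_ge0.
apply: cone_sub; split; last first.
  by rewrite linearD !linearZ /= /GRing.scale /=; lra.
(* Integrality is used here: the weights [- f r.2] and [f q.2] are natural numbers, so the paired
   vector stays in the additive monoid [Y]. *)
have nat_of x z : x = z%:~R :> R -> 0 <= x -> exists m, x = m%:R.
  by move=> ->; rewrite ler0z; case: z => // m _; exists m.
have [zq eq] := Yint _ Yq; have [zr er] := Yint _ Yr.
have [m ->] := nat_of _ _ eq (ltW fq).
have er' : - f r.2 = (- zr)%:~R by rewrite er mulrNz.
have [|m' ->] := nat_of _ _ er'; first by rewrite oppr_ge0 ltW.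
by apply: YD; apply: Yn.
Qed.

End Cones.

(** * Intersections of cones over monoids of integer vectors *)

Section ConeIntersection.
Variables (R : realFieldType) (d : nat).
Implicit Types Y : set 'rV[R]_d.

(** The pair [(v, v)] lies in the cone over the product of [Y1] and [Y2]; [cone_hyperplane] then
    imposes equality of the two components one coordinate at a time, until the generators are
    diagonal. Integrality matters: on the line, the multiples of 1 and those of an irrational number
    span the same cone but meet only in 0. *)
Lemma cone_setI Y1 Y2 v :
    Y1 0 -> (forall x y, Y1 x -> Y1 y -> Y1 (x + y)) ->
    Y2 0 -> (forall x y, Y2 x -> Y2 y -> Y2 (x + y)) ->
    (forall y i, Y1 y -> exists z : int, y 0 i = z%:~R) ->
    (forall y i, Y2 y -> exists z : int, y 0 i = z%:~R) ->
  cone Y1 v -> cone Y2 v -> cone (Y1 `&` Y2) v.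
Proof.
move=> Y10 Y1D Y20 Y2D Y1Z Y2Z c1 c2.
pose V := ('rV[R]_d * 'rV[R]_d)%type.
pose Y (s : seq 'I_d) : set V :=
  [set y | [/\ Y1 y.1, Y2 y.2 & forall i, i \in s -> y.1 0 i = y.2 0 i]].
have cY s : cone (Y s) (v, v).
  elim: s => [|j s IH].
    have -> : (v, v) = (v, 0) + (0, v) :> V by rewrite /GRing.add /= /add_pair /= addr0 add0r.
    apply: coneD.
      apply: (@cone_min _ _ Y1 (fun u => cone (Y [::]) ((u, 0) : V)) _ _ _ _ v c1).
      - exact: cone0.
      - move=> a b ha hb; have -> : (a + b, 0) = (a, 0) + (b, 0) :> V.
          by rewrite [RHS]/GRing.add /= /add_pair /= addr0.
        exact: coneD.
      - move=> a u a0 h; have -> : (a *: u, 0) = a *: ((u, 0) : V).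
          by rewrite [RHS]/GRing.scale /= /scale_pair /= scaler0.
        exact: coneZ.
      - by move=> y Yy; apply: cone_sub.
    apply: (@cone_min _ _ Y2 (fun u => cone (Y [::]) ((0, u) : V)) _ _ _ _ v c2).
    - exact: cone0.
    - move=> a b ha hb; have -> : (0, a + b) = (0, a) + (0, b) :> V.
        by rewrite [RHS]/GRing.add /= /add_pair /= addr0.
      exact: coneD.
    - move=> a u a0 h; have -> : (0, a *: u) = a *: ((0, u) : V).
        by rewrite [RHS]/GRing.scale /= /scale_pair /= scaler0.
      exact: coneZ.
    - by move=> y Yy; apply: cone_sub.
  pose f (y : V) : R^o := y.1 0 j - y.2 0 j.
  have flin : linear f.
    by move=> a x y; rewrite /f /= !mxE scalerBr /GRing.scale /=; lra.
  pose fL : {linear V -> R^o} := HB.pack f (GRing.isLinear.Build _ _ _ _ f flin).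
  have := @cone_hyperplane _ _ (Y s) fL (v, v) _ _ _ IH.
  have -> : [set y | Y s y /\ fL y = 0] = Y (j :: s).
    apply/seteqP; split=> y /=.
      move=> [[a b h] /eqP]; rewrite /f subr_eq0 => /eqP e; split=> // i.
      by rewrite inE => /orP[/eqP->|/h].
    move=> [a b h]; split; last by rewrite /f h ?mem_head ?subrr.
    by split=> // i is_; apply: h; rewrite inE is_ orbT.
  apply; last by rewrite /= /f subrr.
  - by split=> // i _; rewrite !mxE.
  - move=> x y [x1 x2 hx] [y1 y2 hy]; split; [exact: Y1D|exact: Y2D|].
    by move=> i is_; rewrite !mxE hx // hy.
  - move=> y [y1 y2 _]; have [z1 e1] := Y1Z _ j y1; have [z2 e2] := Y2Z _ j y2.
    by exists (z1 - z2); rewrite /= /f e1 e2 rmorphB.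
have := cY (enum 'I_d).
pose Q : set V := [set y | cone (Y1 `&` Y2) y.1].
apply: (@cone_min _ _ _ Q) => /=.
- exact: cone0.
- by move=> x y; apply: coneD.
- by move=> a x; apply: coneZ.
move=> [y1 y2] [/= h1 h2 h]; apply: cone_sub; split=> //.
suff -> : y1 = y2 by [].
by apply/rowP => i; apply: h; rewrite mem_enum.
Qed.

End ConeIntersection.

(** * Farkas' lemma *)

Section Farkas.
Variables (R : realFieldType) (d : nat).
Implicit Types u v : 'rV[R]_d.

Definition dot u v : R := \sum_i u 0 i * v 0 i.

Lemma dotC u v : dot u v = dot v u.
Proof. by apply: eq_bigr => i _; rewrite mulrC. Qed.

Lemma dotDl u v w : dot (u + v) w = dot u w + dot v w.
Proof. by rewrite -big_split; apply: eq_bigr => i _; rewrite mxE mulrDl. Qed.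

Lemma dotZl a u w : dot (a *: u) w = a * dot u w.
Proof. by rewrite mulr_sumr; apply: eq_bigr => i _; rewrite mxE mulrA. Qed.

Lemma dotNl u w : dot (- u) w = - dot u w.
Proof. by rewrite -scaleN1r dotZl mulN1r. Qed.

Lemma dot0l w : dot 0 w = 0.
Proof. by rewrite -(scale0r 0) dotZl mul0r. Qed.

Lemma dotDr u v w : dot w (u + v) = dot w u + dot w v.
Proof. by rewrite dotC dotDl !(dotC w). Qed.

Lemma dotZr a u w : dot w (a *: u) = a * dot w u.
Proof. by rewrite dotC dotZl (dotC w). Qed.

Lemma dotNr u w : dot w (- u) = - dot w u.
Proof. by rewrite dotC dotNl (dotC w). Qed.

Lemma dotr_suml (J : Type) (r : seq J) (P : pred J) (F : J -> 'rV[R]_d) w :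
  dot (\sum_(j <- r | P j) F j) w = \sum_(j <- r | P j) dot (F j) w.
Proof.
elim/big_rec2: _ => [|j x y _ <-]; first exact: dot0l.
by rewrite dotDl.
Qed.

Lemma dot_delta i w : dot (delta_mx 0 i) w = w 0 i.
Proof.
rewrite /dot (bigD1 i) //= mxE !eqxx mul1r big1 ?addr0 // => j /negPf ji.
by rewrite mxE ji andbF mul0r.
Qed.

(* Bartl's algebraic proof, by induction on the number of generators. *)
Lemma farkas (s : seq 'rV[R]_d) b :
    (forall y, (forall a, a \in s -> 0 <= dot a y) -> 0 <= dot b y) ->
  cone [set a | a \in s] b.
Proof.
have [m le_m] := ubnP (size s); elim: m => // m IH in s b le_m *.
case: s le_m => [_|a s /= sm] h.
  have : 0 <= dot b (- b) by apply: h.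
  rewrite dotNr oppr_ge0 /dot => le0.
  have : \sum_i b 0 i * b 0 i == 0.
    by rewrite eq_le le0 sumr_ge0 // => i _; rewrite -expr2 sqr_ge0.
  rewrite psumr_eq0 => [/allP z|i _]; last by rewrite -expr2 sqr_ge0.
  have -> : b = 0; last exact: cone0.
  apply/rowP => i; have := z i (mem_index_enum _).
  by rewrite -expr2 sqrf_eq0 mxE => /eqP.
have [h'|/existsNP[x /not_implyP[hx /negP]]] :=
    pselect (forall y, (forall a, a \in s -> 0 <= dot a y) -> 0 <= dot b y).
  have := IH s b sm h'; apply: cone_mono => w /=; rewrite inE => ->.
  by rewrite orbT.
rewrite -ltNge => bx.
have ax : dot a x < 0.
  rewrite ltNge; apply/negP => ax0; move: bx; rewrite ltNge => /negP; apply.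
  by apply: h => w; rewrite inE => /orP[/eqP->|/hx].
(* [g] projects along [a] onto the hyperplane orthogonal to [x]. Its adjoint, given by [dg], sends
   every [y] to a vector orthogonal to [a], so the hypothesis on [a :: s] applies to that vector.
   The signs of the products with [x] make all the corrections by [a] nonnegative. *)
pose g w := w - (dot w x / dot a x) *: a.
have dg w y : dot (g w) y = dot w (y - (dot a y / dot a x) *: x).
  rewrite /g dotDl dotNl dotZl dotDr dotNr dotZr; congr (_ - _).
  by lra.
have /IH : (size (map g s) < m)%N by rewrite size_map.
move=> /(_ (g b)) [y hy|t ht e].
  rewrite dg; apply: h => w; rewrite inE => /orP[/eqP->|ws].
    by rewrite dotDr dotNr dotZr divfK ?subrr // lt_eqF.
  by rewrite -dg; apply: hy; apply: map_f.
have : cone [set w | w \in a :: s] (g b).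
  rewrite e; apply: cone_sum => q /ht[q0 /mapP[w ws ->]] _; apply: coneZ => //.
  apply: coneD; first by apply: cone_sub; rewrite /= inE ws orbT.
  rewrite -scaleNr; apply: coneZ; last by apply: cone_sub; rewrite /= mem_head.
  rewrite -mulNr mulr_le0 //; first by rewrite oppr_le0 hx.
  by rewrite invr_le0 ltW.
move=> /coneD-/(_ ((dot b x / dot a x) *: a)); rewrite subrK; apply.
apply: coneZ; last by apply: cone_sub; rewrite /= mem_head.
by rewrite mulr_le0 ?ltW // invr_lt0.
Qed.

End Farkas.

(** * Rees monoids *)

Section BigradedExponents.
Variable n : nat.
Implicit Types (s t : 'X_{1..n} * nat) (E : set 'X_{1..n}).

(** Induction on the number [j] of coordinates compared. If [B] bounds coordinate [j] on a finite
    set [G0] that works for the first [j] coordinates, then [G0] handles the elements whose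
    coordinate [j] is at least [B]; the finitely many slices below [B] are handled by induction. *)
Lemma dickson E : exists G : seq 'X_{1..n},
  (forall g, g \in G -> E g) /\
  (forall x, E x -> exists2 g, g \in G & (g <= x)%MM).
Proof.
suff H j : forall E, exists G : seq 'X_{1..n}, (forall g, g \in G -> E g) /\
    (forall x, E x -> exists2 g, g \in G & forall i : 'I_n, (i < j)%N -> (g i <= x i)%N).
  have [G [GE h]] := H n E; exists G; split=> // x /h[g gG le].
  by exists g => //; apply/mnm_lepP => i; apply: le.
elim: j => {E} [|j IH] E.
  have [[x Ex]|nE] := pselect (exists x, E x).
    by exists [:: x]; split=> [g|y _]; [rewrite inE => /eqP->|exists x; rewrite ?mem_head].
  by exists [::]; split=> // x Ex; case: nE; exists x.
have [jn|nj] := ltnP j n; last first.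
  have [G [GE h]] := IH E; exists G; split=> // x /h[g gG le]; exists g => // i _.
  by apply: le; apply: leq_trans nj.
pose i0 := Ordinal jn.
have [G0 [G0E h0]] := IH E.
have /choice[Gb hGb] : forall b, exists G : seq 'X_{1..n},
    (forall g, g \in G -> E g /\ g i0 = b) /\
    (forall x, E x /\ x i0 = b ->
       exists2 g, g \in G & forall i : 'I_n, (i < j)%N -> (g i <= x i)%N).
  by move=> b; apply: (IH [set x | E x /\ x i0 = b]).
pose B := \max_(g <- G0) g i0.
exists (G0 ++ flatten [seq Gb b | b <- iota 0 B]); split=> [g|x Ex].
  rewrite mem_cat => /orP[/G0E//|/flattenP[_ /mapP[b _ ->] /(proj1 (hGb b))[]]].
  by [].
have [lt_xB|le_Bx] := ltnP (x i0) B.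
  have [g gG le] := proj2 (hGb (x i0)) x (conj Ex erefl).
  have [_ gx] := proj1 (hGb (x i0)) g gG.
  exists g => [|i].
    rewrite mem_cat; apply/orP; right; apply/flattenP; exists (Gb (x i0)) => //.
    by apply: map_f; rewrite mem_iota.
  rewrite ltnS leq_eqVlt => /orP[/eqP ij|/le//].
  by have -> : i = i0 by [apply: val_inj]; rewrite gx.
have [g gG le] := h0 x Ex; exists g => [|i]; first by rewrite mem_cat gG.
rewrite ltnS leq_eqVlt => /orP[/eqP ij|/le//].
have -> : i = i0 by apply: val_inj.
by apply: leq_trans le_Bx; apply: leq_bigmax_seq.
Qed.

Definition addx s t : 'X_{1..n} * nat := ((s.1 + t.1)%MM, (s.2 + t.2)%N).
Definition mulx s (m : nat) : 'X_{1..n} * nat := ((s.1 *+ m)%MM, (s.2 * m)%N).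
Definition zerox : 'X_{1..n} * nat := (0%MM, 0%N).
Definition unitx (i : 'I_n) : 'X_{1..n} * nat := (U_(i)%MM, 0%N).

Lemma add0x s : addx zerox s = s.
Proof. by case: s => a k; rewrite /addx add0m. Qed.

Lemma mulxS s m : mulx s m.+1 = addx s (mulx s m).
Proof. by rewrite /mulx /addx mulmS mulnS. Qed.

Lemma mulx0 s : mulx s 0 = zerox.
Proof. by rewrite /mulx mulm0n muln0. Qed.

Definition submonoid (S : set ('X_{1..n} * nat)) :=
  S zerox /\ forall s t, S s -> S t -> S (addx s t).

Lemma submonoid_mulx S s m : submonoid S -> S s -> S (mulx s m).
Proof.
by move=> [S0 SD] Ss; elim: m => [|m IH]; rewrite ?mulx0 // mulxS; apply: SD.
Qed.

Definition upset E := forall a b, E a -> (a <= b)%MM -> E b.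

(** For an up-set [E], this is the exponent monoid of the Rees algebra of the monomial ideal with
    exponents [E]: [(a, m)] belongs to it when [x^a] lies in the m-th power. *)
Definition rees E : set ('X_{1..n} * nat) := [set s | exists g : seq 'X_{1..n},
  [/\ size g = s.2, forall x, x \in g -> E x & (\sum_(x <- g) x <= s.1)%MM]].

Lemma lepm_add (a b c d : 'X_{1..n}) :
  (a <= b)%MM -> (c <= d)%MM -> (a + c <= b + d)%MM.
Proof.
move=> /mnm_lepP h /mnm_lepP h'; apply/mnm_lepP => i.
by rewrite !mnmDE leq_add.
Qed.

Lemma le0mm (a : 'X_{1..n}) : (0 <= a)%MM.
Proof. by apply/mnm_lepP => i; rewrite mnm0E. Qed.

Lemma rees0 E a : rees E (a, 0%N).
Proof. by exists [::]; split=> //; rewrite big_nil; exact: le0mm. Qed.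

Lemma rees1 E a : E a -> rees E (a, 1%N).
Proof.
move=> Ea; exists [:: a]; split=> //; last by rewrite big_seq1 lepm_refl.
by move=> x; rewrite inE => /eqP->.
Qed.

Lemma rees_submonoid E : submonoid (rees E).
Proof.
split; first exact: rees0.
move=> s t [g [gs gE gl]] [h [hs hE hl]]; exists (g ++ h); split.
- by rewrite size_cat gs hs.
- by move=> x; rewrite mem_cat => /orP[/gE|/hE].
- by rewrite big_cat; apply: lepm_add.
Qed.

Lemma reesT s : rees setT s.
Proof.
exists (nseq s.2 0%MM); split=> //; first by rewrite size_nseq.
by rewrite big1_seq ?le0mm // => x /andP[_]; rewrite mem_nseq => /andP[_ /eqP].
Qed.

(* A face of a monoid [S] containing N^n x 0 whose monomials stay nonzero in
   the quotient of k[S] by the variables. *)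
Record fiber_face (S F : set ('X_{1..n} * nat)) : Prop := FiberFace {
  fface_sub : F `<=` S;
  fface0 : F zerox;
  ffaceD : forall s t, S s -> S t -> F (addx s t) <-> F s /\ F t;
  fface_unit : forall i, ~ F (unitx i) }.

Lemma fface_mulx S F s m : fiber_face S F -> F s -> F (mulx s m).
Proof.
move=> [FS F0 FD _] Fs; apply: submonoid_mulx => //; split=> // a b Fa Fb.
by apply/(FD a b); [apply: FS|apply: FS|].
Qed.

(** A nonzero exponent of height 0 is divisible by a variable, and a face contains the divisors in
    [S] of its elements. Hence elements of the face can be scaled to height 1. *)
Lemma fface_gt0 S F s : fiber_face S F -> (forall a, S (a, 0%N)) ->
  F s -> s <> zerox -> (0 < s.2)%N.
Proof.
move=> [FS F0 FD Fi] S0; case: s => a [|//] Fa a0; exfalso.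
have [i ai] : exists i, (0 < a i)%N.
  apply/not_existsP => h; apply: a0; rewrite /zerox; congr (_, _); apply/mnmP => i; rewrite mnm0E.
  by have := h i; case: (a i).
have e : (a, 0%N) = addx (unitx i) ((a - U_(i))%MM, 0%N).
  congr (_, _); rewrite addmC submK //.
  by rewrite lep1mP -lt0n.
apply: (Fi i); rewrite e in Fa.
by have [] := (FD (unitx i) _ (S0 _) (S0 _)).1 Fa.
Qed.

End BigradedExponents.

(** * Exponents as vectors at a height, and the cones they span *)

Section HomogeneousVectors.
Variables (R : realFieldType) (n : nat).
Implicit Types (v w : 'rV[R]_n) (u : 'rV[R]_(n + 1)) (s t : 'X_{1..n} * nat).

Definition homv v (x : R) : 'rV[R]_(n + 1) := row_mx v (const_mx x).

Lemma homvL v x i : homv v x 0 (lshift 1 i) = v 0 i.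
Proof. by rewrite row_mxEl. Qed.

Lemma homvR v x i : homv v x 0 (rshift n i) = x.
Proof. by rewrite row_mxEr mxE. Qed.

Lemma homv_sub u : homv (lsubmx u) (u 0 (rshift n 0)) = u.
Proof.
rewrite -[RHS]hsubmxK; congr row_mx; apply/rowP => i.
by rewrite !mxE (ord1 i).
Qed.

Lemma homvD v w x y : homv v x + homv w y = homv (v + w) (x + y).
Proof. by rewrite /homv add_row_mx; congr row_mx; apply/rowP => i; rewrite !mxE. Qed.

Lemma homvZ a v x : a *: homv v x = homv (a *: v) (a * x).
Proof. by rewrite /homv scale_row_mx; congr row_mx; apply/rowP => i; rewrite !mxE. Qed.

Lemma homv0 : homv 0 0 = 0.
Proof. by rewrite -[RHS]row_mx0; congr row_mx; apply/rowP => i; rewrite !mxE. Qed.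

Lemma dot_homv v w x y : dot (homv v x) (homv w y) = dot v w + x * y.
Proof.
rewrite /dot big_split_ord /= big_ord1 !homvR; congr (_ + _).
by apply: eq_bigr => i _; rewrite !homvL.
Qed.

Definition vec (m : 'X_{1..n}) : 'rV[R]_n := \row_i (m i)%:R.
Definition hv s : 'rV[R]_(n + 1) := homv (vec s.1) s.2%:R.

Lemma vecD a b : vec (a + b)%MM = vec a + vec b.
Proof. by apply/rowP => i; rewrite !mxE mnmDE natrD. Qed.

Lemma hvD s t : hv (addx s t) = hv s + hv t.
Proof. by rewrite /hv homvD vecD natrD. Qed.

Lemma hv0 : hv (zerox n) = 0.
Proof.
by rewrite -[RHS]homv0; congr homv; apply/rowP => i; rewrite !mxE mnm0E.
Qed.

Lemma hvM s m : hv (mulx s m) = m%:R *: hv s.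
Proof.
elim: m => [|m IH]; first by rewrite mulx0 hv0 scale0r.
by rewrite mulxS hvD IH mulrS scalerDl scale1r.
Qed.

Lemma hv_inj : injective hv.
Proof.
move=> [a k] [b l] /= /rowP h; congr (_, _).
  apply/mnmP => i; have := h (lshift 1 i); rewrite !homvL !mxE => /eqP.
  by rewrite eqr_nat => /eqP.
have := h (rshift n 0); rewrite !homvR => /eqP.
by rewrite eqr_nat => /eqP.
Qed.

Lemma hv_nat s i : exists m : nat, hv s 0 i = m%:R.
Proof.
case: (split_ordP i) => j ->; first by rewrite homvL mxE; exists (s.1 j).
by rewrite homvR; exists s.2.
Qed.

Lemma hv_ge0 s i : 0 <= hv s 0 i.
Proof. by have [m ->] := hv_nat s i. Qed.

Lemma hv_sum (J : Type) (r : seq J) (f : J -> 'X_{1..n} * nat) :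
  hv (\big[@addx n/zerox n]_(j <- r) f j) = \sum_(j <- r) hv (f j).
Proof. by elim/big_rec2: _ => [|j x y _ <-]; rewrite ?hv0 ?hvD. Qed.

Lemma dot_unitx i u : dot (hv (unitx i)) u = u 0 (lshift 1 i).
Proof.
rewrite -[u]homv_sub dot_homv mul0r addr0 homvL.
rewrite -dot_delta; congr (dot _ _); apply/rowP => j.
by rewrite !mxE mnm1E eqxx eq_sym.
Qed.

Definition Rees_gens (G : set 'X_{1..n}) : set 'rV[R]_(n + 1) :=
  [set hv (g, 1%N) | g in G] `|` [set hv (unitx i) | i in setT].

Lemma cone_orthant (v : 'rV[R]_n) G : (forall i, 0 <= v 0 i) -> cone (Rees_gens G) (homv v 0).
Proof.
move=> v0; have -> : homv v 0 = \sum_i v 0 i *: hv (unitx i).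
  apply/rowP => j; rewrite summxE; case: (split_ordP j) => i ->.
    rewrite homvL (bigD1 i) //= big1 ?addr0 => [|l /negPf li].
      by rewrite mxE homvL mxE mnm1E eqxx mulr1.
    by rewrite mxE homvL mxE mnm1E li mulr0.
  by rewrite homvR big1 // => l _; rewrite mxE homvR mulr0.
apply: cone_sum => i _ _; apply: coneZ => //; apply: cone_sub; right.
by exists i.
Qed.

(** The factors are peeled off one by one, each replaced by a generator below it; the surplus is
    nonnegative of height 0, hence a combination of the [hv (unitx i)]. *)
Lemma cone_rees E G : (forall x, E x -> exists2 g, G g & (g <= x)%MM) ->
  cone [set hv s | s in rees E] `<=` cone (Rees_gens G).
Proof.
move=> EG; apply: cone_idem => _ [[a k] [g [/= <- {k} gE ga]] <-].
elim: g a gE ga => [|x g IH] a gE.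
  move=> _; apply: cone_orthant => i.
  by rewrite mxE.
rewrite big_cons => ga.
have le_xa : (x <= a)%MM by apply: lepm_trans ga; apply: lem_addr.
have -> : (a, size (x :: g)) = addx (x, 1%N) ((a - x)%MM, size g).
  by congr (_, _); rewrite /= addmC submK.
rewrite hvD; apply: coneD; last first.
  apply: IH => [y yg|]; first by apply: gE; rewrite inE yg orbT.
  apply/mnm_lepP => i; move/mnm_lepP/(_ i): ga; rewrite mnmDE mnmBE.
  by lia.
have [h Gh hx] := EG x (gE x (mem_head _ _)).
have -> : (x, 1%N) = addx (h, 1%N) ((x - h)%MM, 0%N).
  by congr (_, _); rewrite /= addmC submK.
rewrite hvD; apply: coneD; first by apply: cone_sub; left; exists h.
by apply: cone_orthant => i; rewrite mxE.
Qed.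

Lemma cone_hv_setI (A B : set ('X_{1..n} * nat)) u : submonoid A -> submonoid B ->
  cone [set hv s | s in A] u -> cone [set hv s | s in B] u ->
  cone [set hv s | s in A `&` B] u.
Proof.
move=> [A0 AD] [B0 BD] cA cB.
have -> : [set hv s | s in A `&` B] = [set hv s | s in A] `&` [set hv s | s in B].
  apply/seteqP; split=> [_ [s [As Bs] <-]|_ [[s As <-] [t Bt /hv_inj e]]].
    by split; exists s.
  by exists s => //; split=> //; rewrite -e.
have int (C : set ('X_{1..n} * nat)) y i : [set hv s | s in C] y -> exists z : int, y 0 i = z%:~R.
  by move=> [s _ <-]; have [m ->] := hv_nat s i; exists m.
apply: cone_setI => //; try exact: int; try by exists (zerox n); rewrite ?hv0.
- by move=> _ _ [s As <-] [t At <-]; exists (addx s t); rewrite ?hvD //; apply: AD.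
- by move=> _ _ [s As <-] [t At <-]; exists (addx s t); rewrite ?hvD //; apply: BD.
Qed.

(** By [cone_hv_setI], [hv s] is in the cone over the intersection of [S] with the monoid of
    multiples of [s]. If [s] is nonzero, that intersection cannot be reduced to zero. *)
Lemma cone_hv_mulx S s : submonoid S -> cone [set hv s | s in S] (hv s) ->
  exists2 m, (0 < m)%N & S (mulx s m).
Proof.
move=> SS cs; have [s0|s0] := eqVneq s (zerox n).
  by exists 1%N => //; apply: submonoid_mulx => //; rewrite s0; case: SS.
pose T : set ('X_{1..n} * nat) := [set mulx s m | m in setT].
have TT : submonoid T.
  split; first by exists 0%N; rewrite ?mulx0.
  move=> _ _ [m _ <-] [l _ <-]; exists (m + l)%N => //.
  by apply: hv_inj; rewrite hvD !hvM natrD scalerDl.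
have cT : cone [set hv t | t in T] (hv s).
  by apply: cone_sub; exists s => //; exists 1%N => //; rewrite /mulx mulm1n muln1; case: (s).
have [r hr e] := cone_hv_setI SS TT cs cT.
apply: contrapT => h; case/eqP: s0; apply: hv_inj; rewrite hv0 e big_seq big1 // => q /hr[_].
move=> [t [St [m _ tE]] <-]; case: m => [|m] in tE *; last by case: h; exists m.+1; rewrite ?tE.
by rewrite -tE mulx0 hv0 scaler0.
Qed.

Section Family.
Variables (J : finType) (E : J -> set 'X_{1..n}).

Definition rees_family : set ('X_{1..n} * nat) := [set s | forall j, rees (E j) s].

Lemma rees_family_submonoid : submonoid rees_family.
Proof.
split=> [j|s t hs ht j]; first by have [] := rees_submonoid (E j).
by have [_] := rees_submonoid (E j); apply.
Qed.

Lemma rees_family0 a : rees_family (a, 0%N).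
Proof. by move=> j; apply: rees0. Qed.

Lemma cone_rees_family u : (forall i, 0 <= u 0 i) ->
  (forall j, cone [set hv s | s in rees (E j)] u) ->
  cone [set hv s | s in rees_family] u.
Proof.
move=> u0 cu.
suff : cone [set hv s | s in [set s | forall j, j \in enum J -> rees (E j) s]] u.
  apply: cone_mono => _ [s h <-]; exists s => // j; apply: h.
  by rewrite mem_enum.
elim: (enum J) => [|j r IH].
  (* The empty intersection consists of all exponents, whose cone is the orthant; this is where
     nonnegativity of [u] enters. *)
  rewrite -[u]homv_sub -[X in homv _ X]add0r -[lsubmx u]addr0 -homvD [homv (lsubmx u) 0 + _]addrC.
  apply: coneD.
    have -> : homv 0 (u 0 (rshift n 0)) = u 0 (rshift n 0) *: hv (0%MM, 1%N).
      rewrite /hv homvZ mulr1; congr homv; apply/rowP => i.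
      by rewrite !mxE mnm0E mulr0.
    by apply: coneZ => //; apply: cone_sub; exists (0%MM, 1%N).
  have : cone (Rees_gens set0) (homv (lsubmx u) 0) by apply: cone_orthant => i; rewrite mxE.
  apply: cone_mono => _ [[? []]//|[i _ <-]].
  by exists (unitx i).
have -> : [set s | forall i, i \in j :: r -> rees (E i) s] =
    rees (E j) `&` [set s | forall i, i \in r -> rees (E i) s].
  apply/seteqP; split=> s /=.
    by move=> h; split=> [|i ir]; apply: h; rewrite inE ?eqxx ?ir ?orbT.
  by move=> [h1 h2] i; rewrite inE => /orP[/eqP->|/h2].
apply: cone_hv_setI => //; first exact: rees_submonoid.
split=> [i _|s t hs ht i ir]; first by have [] := rees_submonoid (E i).
by have [_] := rees_submonoid (E i); apply; [apply: hs|apply: ht].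
Qed.

End Family.

End HomogeneousVectors.

Arguments hv {R n} s.
Arguments vec {R n} m.

(** * Newton polyhedra *)

Section NewtonPolyhedra.
Variables (R : realType) (n : nat) (E : set 'X_{1..n}).
Hypothesis E_up : upset E.
Implicit Types v w : 'rV[R]_n.

Definition newton : set 'rV[R]_n :=
  smallest (@convex_set R 'rV[R]_n) [set vec m | m in E].

Lemma newton_vec m : E m -> newton (vec m).
Proof. by move=> Em A [_ EA]; apply: EA; exists m. Qed.

Lemma newton_conv v w (t : R) : 0 <= t -> t <= 1 ->
  newton v -> newton w -> newton (t *: v + (1 - t) *: w).
Proof.
move=> t0 t1 hv hw A /= [cA EA].
have := cA v w (Itv01 t0 t1).
rewrite !inE; apply; [by apply: hv|by apply: hw].
Qed.

Lemma newton_min (Q : set 'rV[R]_n) :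
    (forall v w (t : R), 0 <= t -> t <= 1 -> Q v -> Q w -> Q (t *: v + (1 - t) *: w)) ->
    (forall m, E m -> Q (vec m)) ->
  newton `<=` Q.
Proof.
move=> Qc QE; apply: smallest_sub => [v w t|_ [m Em <-]]; last exact: QE.
by rewrite !inE => Qv Qw; apply: Qc.
Qed.

(** By convexity it suffices to treat exponents [m] of [E]. Then [vec m + t e_i] lies on the segment
    from [vec m] to [vec m + N.+1 e_i] as soon as the integer [N.+1] exceeds [t], and [E] is an
    up-set. *)
Lemma newton_delta v i (t : R) : 0 <= t -> newton v -> newton (v + t *: delta_mx 0 i).
Proof.
move=> t0; move: v; apply: newton_min => [v w l l0 l1 hv hw|m Em].
  have -> : l *: v + (1 - l) *: w + t *: delta_mx 0 i =
     l *: (v + t *: delta_mx 0 i) + (1 - l) *: (w + t *: delta_mx 0 i).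
    by apply/rowP => j; rewrite !mxE; lra.
  exact: newton_conv.
have [N tN] : exists N : nat, t <= N.+1%:R.
  exists (Num.truncn t); apply: ltW.
  by rewrite truncnS_gt.
have N0 : 0 < N.+1%:R :> R by [].
have -> : vec m + t *: delta_mx 0 i = (t / N.+1%:R) *: vec (m + U_(i) *+ N.+1)%MM
     + (1 - t / N.+1%:R) *: vec m :> 'rV[R]_n.
  have tq : t = t / N.+1%:R * N.+1%:R by rewrite divfK ?gt_eqF.
  apply/rowP => j; rewrite !mxE mnmDE mulmnE mnm1E /= eq_sym natrD natrM.
  move: (t / _) tq => q ->; lra.
apply: newton_conv; last exact: newton_vec.
- by rewrite divr_ge0.
- by rewrite ler_pdivrMr // mul1r.
- by apply: newton_vec; apply: E_up Em _; apply: lem_addr.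
Qed.

Lemma newton_up v w : (forall i, 0 <= w 0 i) -> newton v -> newton (v + w).
Proof.
move=> w0 hv; rewrite [w]row_sum_delta.
elim/big_rec: _ v hv => [|i x _ IH] v hv; first by rewrite addr0.
by rewrite addrA; apply: IH; apply: newton_delta.
Qed.

Lemma newton_cone v : newton v <-> cone [set hv s | s in rees E] (homv v 1).
Proof.
split.
  move: v; apply: newton_min => [v w t t0 t1 hv hw|m Em]; last first.
    by apply: cone_sub; exists (m, 1%N) => //; apply: rees1.
  have -> : homv (t *: v + (1 - t) *: w) 1 = t *: homv v 1 + (1 - t) *: homv w 1.
    by rewrite !homvZ homvD; congr homv; lra.
  by apply: coneD; apply: coneZ; rewrite ?subr_ge0.
(* Dehomogenization: points of positive height, rescaled to height 1, must lie in the polyhedron,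
   while points of height 0 are recession directions and only need to be nonnegative. *)
pose Q : set 'rV[R]_(n + 1) := [set u : 'rV[R]_(n + 1) |
   (forall i, 0 <= u 0 i) /\
   (0 < u 0 (rshift n 0) -> newton ((u 0 (rshift n 0))^-1 *: lsubmx u))].
move=> cv; suff : Q (homv v 1).
  by move=> [_]; rewrite homvR invr1 scale1r row_mxKl; apply.
have := cone_rees (fun x Ex => ex_intro2 _ _ x Ex (lepm_refl x)) cv.
apply: cone_min => {v cv}.
- by split=> [i|]; rewrite mxE ?ltxx.
- move=> u u' [u0 hu] [u0' hu']; split=> [i|].
    by rewrite mxE; apply: addr_ge0; [apply: u0|apply: u0'].
  rewrite linearD mxE; set t := u 0 _; set t' := u' 0 _ => tt.
  have t0 : 0 <= t by apply: u0.
  have t0' : 0 <= t' by apply: u0'.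
  have [tz|tz] := eqVneq t 0.
    rewrite scalerDr [_ *: lsubmx u + _]addrC; apply: newton_up.
      by move=> i; rewrite !mxE; apply: mulr_ge0; [rewrite invr_ge0 ltW|apply: u0].
    by rewrite tz add0r in tt *; apply: hu'.
  have [tz'|tz'] := eqVneq t' 0.
    rewrite scalerDr; apply: newton_up.
      by move=> i; rewrite !mxE; apply: mulr_ge0; [rewrite invr_ge0 ltW|apply: u0'].
    by rewrite tz' addr0 in tt *; apply: hu.
  have tp : 0 < t by rewrite lt_neqAle eq_sym tz.
  have tp' : 0 < t' by rewrite lt_neqAle eq_sym tz'.
  have -> : (t + t')^-1 *: (lsubmx u + lsubmx u') =
     (t / (t + t')) *: (t^-1 *: lsubmx u) + (1 - t / (t + t')) *: (t'^-1 *: lsubmx u').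
    have -> : 1 - t / (t + t') = t' / (t + t').
      by rewrite -[X in X - _](divff (lt0r_neq0 tt)) -mulrBl addrAC subrr add0r.
    by rewrite scalerDr !scalerA; congr (_ *: _ + _ *: _); rewrite mulrAC divff ?mul1r.
  apply: newton_conv.
  - by rewrite divr_ge0 // ltW.
  - by rewrite ler_pdivrMr // mul1r lerDl.
  - exact: hu.
  - exact: hu'.
- move=> a u a0 [u0 hu]; split=> [i|]; first by rewrite mxE; apply: mulr_ge0.
  rewrite mxE linearZ /= => au.
  have ap : a != 0 by apply: contraTneq au => ->; rewrite mul0r ltxx.
  have up : 0 < u 0 (rshift n 0).
    by move: au; rewrite pmulr_rgt0 // lt_neqAle eq_sym ap.
  by rewrite scalerA invfM mulrAC mulVf // mul1r; apply: hu.
- move=> _ [[g Eg <-]|[i _ <-]]; split=> [j|]; try exact: hv_ge0; rewrite homvR ?ltxx //.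
  by rewrite invr1 scale1r row_mxKl => _; apply: newton_vec.
Qed.

End NewtonPolyhedra.

Arguments newton R {n} E.

Section PolyhedronOfFamily.
Variables (R : realType) (n : nat) (J : finType) (E : J -> set 'X_{1..n}).
Hypothesis E_up : forall j, upset (E j).

Definition family_polyhedron : set 'rV[R]_n :=
  [set v : 'rV[R]_n | (forall i, 0 <= v 0 i) /\ forall j, newton R (E j) v].

Lemma family_polyhedron_cone v :
  family_polyhedron v <-> cone [set hv s | s in rees_family E] (homv v 1).
Proof.
split=> [[v0 hv]|cv].
  apply: cone_rees_family => [i|j]; last by apply/newton_cone.
  by case: (split_ordP i) => l ->; rewrite ?homvL ?homvR.
split=> [i|j].
  rewrite -(homvL v 1 i); move: (lshift 1 i) => l.
  apply: (@cone_min _ _ _ [set u : 'rV[R]_(n + 1) | 0 <= u 0 l] _ _ _ _ _ cv) => /=.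
  - by rewrite mxE.
  - by move=> x y; rewrite mxE; apply: addr_ge0.
  - by move=> a x a0; rewrite mxE; apply: mulr_ge0.
  - by move=> _ [s _ <-]; apply: hv_ge0.
apply/newton_cone => //; apply: cone_mono cv => _ [s hs <-].
by exists s => //; apply: hs.
Qed.

End PolyhedronOfFamily.

Arguments family_polyhedron R {n J} E _.

(** * Compact faces *)

Section LinearIndependence.
Variables (K : fieldType) (d : nat).

Definition lin_indep m (x : 'I_m -> 'rV[K]_d) : Prop :=
  forall w : 'I_m -> K, \sum_i w i *: x i = 0 -> forall i, w i = 0.

Lemma lin_indepP m (x : 'I_m -> 'rV[K]_d) :
  lin_indep x <-> row_free (\matrix_i x i).
Proof.
have sumE (v : 'rV_m) : v *m (\matrix_i x i) = \sum_i v 0 i *: x i.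
  by rewrite mulmx_sum_row; apply: eq_bigr => i _; rewrite rowK.
split=> [li|fr w e i].
  apply: inj_row_free => v; rewrite sumE => /li h.
  by apply/rowP => i; rewrite h mxE.
have /eqP : (\row_i w i) *m (\matrix_i x i) = 0.
  by rewrite sumE -[RHS]e; apply: eq_bigr => j _; rewrite mxE.
rewrite mulmx_free_eq0 // => /eqP/rowP/(_ i).
by rewrite !mxE.
Qed.

Lemma lin_indep_comp m p (x : 'I_p -> 'rV[K]_d) (f : 'I_m -> 'I_p) :
  injective f -> lin_indep x -> lin_indep (x \o f).
Proof.
move=> f_inj li w e i.
have /li/(_ (f i)) : \sum_l (\sum_(j | f j == l) w j) *: x l = 0.
  rewrite -[RHS]e (partition_big f xpredT) //=; apply: eq_bigr => l _.
  by rewrite scaler_suml; apply: eq_bigr => j /eqP <-.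
rewrite (big_pred1 i) // => j; exact: inj_eq.
Qed.

End LinearIndependence.

(** The vectors of [Y] occurring in the combinations span all the [x i], so the matrix [A] of these
    vectors has rank at least [m], and a maximal free family of its rows provides the [z i]. *)
Lemma lin_indep_cone (R : realFieldType) d m (x : 'I_m -> 'rV[R]_d) (Y : set 'rV[R]_d) :
    lin_indep x -> (forall i, cone Y (x i)) ->
  exists z : 'I_m -> 'rV[R]_d, (forall i, Y (z i)) /\ lin_indep z.
Proof.
move=> /lin_indepP frx cx.
have /choice[r hr] : forall i, exists r : seq (R * 'rV[R]_d),
    (forall q, q \in r -> Y q.2) /\ x i = \sum_(q <- r) q.1 *: q.2.
  by move=> i; have [r hr ->] := cx i; exists r; split=> // q /hr[].
pose L := flatten [seq [seq q.2 | q <- r i] | i <- enum 'I_m].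
have LY a : a \in L -> Y a.
  by move=> /flattenP[_ /mapP[i _ ->] /mapP[q qr ->]]; apply: (hr i).1.
pose A := \matrix_(l < size L) L`_l.
have le_xA : (\matrix_i x i <= A)%MS.
  apply/row_subP => i; rewrite rowK (hr i).2 big_seq.
  apply: summx_sub => q qr; apply: scalemx_sub.
  have qL : q.2 \in L.
    apply/flattenP; exists [seq q.2 | q <- r i]; last exact: map_f.
    by apply/mapP; exists i => //; rewrite mem_enum.
  have lt : (index q.2 L < size L)%N by rewrite index_mem.
  have -> : q.2 = row (Ordinal lt) A by rewrite rowK /= nth_index.
  exact: row_sub.
have le_m : (m <= \rank A)%N by rewrite -(eqP frx); apply: mxrankS.
have fr := maxrowsub_free A.
pose f i := maxrankfun A (widen_ord le_m i).
exists (fun i => L`_(f i)); split=> [i|]; first by apply: LY; apply: mem_nth.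
have : lin_indep (fun l => L`_(maxrankfun A l)).
  apply/lin_indepP; suff -> : \matrix_l L`_(maxrankfun A l) = rowsub (maxrankfun A) A by [].
  by apply/matrixP => i j; rewrite !mxE.
apply: (lin_indep_comp (f := widen_ord le_m)) => i j /(congr1 val) /= e.
exact: val_inj.
Qed.

(** * Supporting functionals: faces of the monoid versus compact faces of the polyhedron *)

Section CompactFaces.
Variables (R : realType) (n : nat).
Implicit Types (u y : 'rV[R]_(n + 1)) (v : 'rV[R]_n) (s t : 'X_{1..n} * nat).

Lemma cone_hv_ge0 (A : set ('X_{1..n} * nat)) u i : cone [set hv s | s in A] u -> 0 <= u 0 i.
Proof.
move=> cu; apply: (@cone_min _ _ _ [set u : 'rV[R]_(n + 1) | 0 <= u 0 i] _ _ _ _ _ cu) => /=.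
- by rewrite mxE.
- by move=> a b; rewrite mxE; apply: addr_ge0.
- by move=> a x a0; rewrite mxE; apply: mulr_ge0.
- by move=> _ [s _ <-]; apply: hv_ge0.
Qed.

Lemma cone_dot_ge0 d (Y : set 'rV[R]_d) (u y : 'rV[R]_d) :
  (forall a, Y a -> 0 <= dot a y) -> cone Y u -> 0 <= dot u y.
Proof.
move=> h; apply: (@cone_min _ _ _ [set u : 'rV[R]_d | 0 <= dot u y]) => //=.
- by rewrite dot0l.
- by move=> a b; rewrite dotDl; apply: addr_ge0.
- by move=> a x a0; rewrite dotZl; apply: mulr_ge0.
Qed.

Lemma dot_continuous (c : 'rV[R]_n) : continuous (fun v : 'rV[R]_n => dot v c).
Proof.
rewrite /dot; elim: (index_enum _) => [|i r IH].
  have -> : (fun v : 'rV[R]_n => \sum_(i <- [::]) v 0 i * c 0 i) = cst 0.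
    by apply/funext => v; rewrite big_nil.
  exact: cst_continuous.
have -> : (fun v : 'rV[R]_n => \sum_(l <- i :: r) v 0 l * c 0 l) =
    (fun v => v 0 i * c 0 i) \+ (fun v => \sum_(l <- r) v 0 l * c 0 l).
  by apply/funext => v; rewrite big_cons.
move=> v; apply: continuousD; last exact: IH.
by apply: continuousM; [exact: coord_continuous|exact: cst_continuous].
Qed.

Lemma rees_fg (E : set 'X_{1..n}) : exists L : seq 'rV[R]_(n + 1),
  cone [set hv s | s in rees E] `<=` cone [set a | a \in L] /\
  (forall a, a \in L -> exists2 s, rees E s & a = hv s).
Proof.
have [G [GE EG]] := dickson E.
pose L : seq 'rV[R]_(n + 1) := [seq hv (g, 1%N) | g <- G] ++ [seq hv (unitx i) | i <- enum 'I_n].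
exists L; split=> [|a].
  apply: subset_trans (cone_rees EG) _; apply: cone_mono => _ [[g gG <-]|[i _ <-]] /=.
    by rewrite mem_cat; apply/orP; left; apply: (map_f (fun g => hv (g, 1%N))).
  by rewrite mem_cat; apply/orP; right; apply: map_f; rewrite mem_enum.
rewrite mem_cat => /orP[/mapP[g gG ->]|/mapP[i _ ->]].
  by exists (g, 1%N) => //; apply: rees1; apply: GE.
by exists (unitx i) => //; apply: rees0.
Qed.

Lemma cone_rees_dual (E : set 'X_{1..n}) u :
    (forall y, (forall s, rees E s -> 0 <= dot (hv s) y) -> 0 <= dot u y) ->
  cone [set hv s | s in rees E] u.
Proof.
move=> h; have [L [EL LE]] := rees_fg E.
have : cone [set a | a \in L] u.
  apply: farkas => y yL; apply: h => s Es.
  apply: (@cone_dot_ge0 _ [set a | a \in L]) => //.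
  by apply: EL; apply: cone_sub; exists s.
by apply: cone_mono => a /LE[s Es ->]; exists s.
Qed.

(** The second alternative says that [e_j] lies in the smallest face of the cone containing [s]. If
    no functional separates [e_j] from that face, Farkas' lemma with [- hv s] added to the
    generators expresses [- e_j], and [mu] is the total weight of [- hv s]. *)
Lemma rees_facet (E : set 'X_{1..n}) s j : rees E s ->
  (exists y, [/\ forall t, rees E t -> 0 <= dot (hv t) y, dot (hv s) y = 0
     & 0 < y 0 (lshift 1 j)]) \/
  exists2 mu : R, 0 <= mu & cone [set hv t | t in rees E] (mu *: hv s - hv (unitx j)).
Proof.
move=> Es; have [L [EL LE]] := rees_fg E.
have [[y [yE ys yj]]|ny] := pselect (exists y, [/\ forall t, rees E t -> 0 <= dot (hv t) y,
    dot (hv s) y = 0 & 0 < y 0 (lshift 1 j)]); first by left; exists y.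
right; have : cone [set a | a \in - hv s :: L] (- hv (unitx j)).
  apply: farkas => y hy; rewrite dotNl oppr_ge0 dot_unitx leNgt; apply/negP => yj.
  apply: ny; exists y.
  have yE t : rees E t -> 0 <= dot (hv t) y.
    move=> Et; apply: (@cone_dot_ge0 _ [set a | a \in L]) => [a aL|].
      by apply: hy; rewrite inE aL orbT.
    by apply: EL; apply: cone_sub; exists t.
  split=> //; apply/eqP; rewrite eq_le yE // andbT.
  by have := hy _ (mem_head _ _); rewrite dotNl oppr_ge0.
suff /(_ (- hv (unitx j))) H : cone [set a | a \in - hv s :: L] `<=`
    [set u | exists2 mu : R, 0 <= mu & cone [set hv t | t in rees E] (mu *: hv s + u)].
  exact: H.
apply: cone_min => /=.
- by exists 0; rewrite ?scale0r ?addr0 //; apply: cone0.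
- move=> a b [l l0 cl] [m m0 cm]; exists (l + m); first exact: addr_ge0.
  by rewrite scalerDl addrACA; apply: coneD.
- move=> a u a0 [m m0 cm]; exists (a * m); first exact: mulr_ge0.
  by rewrite -scalerA -scalerDr; apply: coneZ.
- move=> a /=; rewrite inE => /orP[/eqP->|/LE[t Et ->]].
    by exists 1; rewrite ?scale1r ?subrr //; apply: cone0.
  by exists 0; rewrite ?scale0r ?add0r //; apply: cone_sub; exists t.
Qed.

Variables (J : finType) (E : J -> set 'X_{1..n}).
Hypothesis E_up : forall j, upset (E j).
Let S := rees_family E.
Let P := family_polyhedron R E.
(** The extra index [None] carries all exponents; it provides the nonnegativity required by
    [cone_rees_family], even when [J] is empty. *)
Let Eo (o : option J) : set 'X_{1..n} := if o is Some j then E j else setT.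

Let S_Eo s o : S s -> rees (Eo o) s.
Proof. by case: o => [j|] Ss /=; [apply: Ss|apply: reesT]. Qed.

Let cone_S u : (forall o, cone [set hv s | s in rees (Eo o)] u) ->
  cone [set hv s | s in S] u.
Proof.
move=> h; apply: cone_rees_family => [i|j]; last exact: (h (Some j)).
exact: cone_hv_ge0 (h None).
Qed.

(** By duality for each Rees cone, [P] is the intersection of the closed half-spaces given by the
    functionals nonnegative on [S]. *)
Lemma closed_family_polyhedron : closed P.
Proof.
pose D := [set y : 'rV[R]_(n + 1) | forall s, S s -> 0 <= dot (hv s) y].
have -> : P = \bigcap_(y in D) [set v : 'rV[R]_n | 0 <= dot (homv v 1) y].
  apply/seteqP; split=> [v /family_polyhedron_cone-/(_ E_up) cv y Dy /=|v hv'].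
    by apply: cone_dot_ge0 cv => _ [s Ss <-]; apply: Dy.
  apply/family_polyhedron_cone => //; apply: cone_S => o; apply: cone_rees_dual => y hy.
  by apply: hv' => s Ss; apply: hy; apply: S_Eo.
apply: closed_bigI => y _.
have -> : [set v : 'rV[R]_n | 0 <= dot (homv v 1) y] =
   (fun v : 'rV[R]_n => dot v (lsubmx y)) @^-1` [set x | - y 0 (rshift n 0) <= x].
  have e v : dot (homv v 1) y = dot v (lsubmx y) + y 0 (rshift n 0).
    by rewrite -{1}[y]homv_sub dot_homv mul1r.
  by apply/seteqP; split=> v /=; rewrite e -lerBlDr sub0r.
apply: closed_comp; last exact: closed_ge.
by move=> v _; apply: dot_continuous.
Qed.

(** Functionals found for each variable separately are summed. If none existed for [e_j], every Rees
    cone of the family would contain [mu s - e_j] for some [mu]; with a common integer [N], some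
    positive multiple of [N s - e_j] would lie in [S]. Then [e_j] would divide a multiple of [s] in
    [S], and would belong to the face [F]. *)
Lemma fiber_face_support F s : fiber_face S F -> F s ->
  exists y, [/\ forall t, S t -> 0 <= dot (hv t) y, dot (hv s) y = 0
     & forall j, 0 < y 0 (lshift 1 j)].
Proof.
move=> FF Fs; have Ss := fface_sub FF Fs.
have S0 a : S (a, 0%N) by apply: rees_family0.
have SS : submonoid S by apply: rees_family_submonoid.
suff /choice[y hy] : forall j, exists y, [/\ forall t, S t -> 0 <= dot (hv t) y,
    dot (hv s) y = 0 & 0 < y 0 (lshift 1 j)].
  exists (\sum_j y j).
  have dsum t : dot (hv t) (\sum_j y j) = \sum_j dot (hv t) (y j).
    by rewrite dotC dotr_suml; apply: eq_bigr => j _; rewrite dotC.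
  have ge0 j t : S t -> 0 <= dot (hv t) (y j) by case: (hy j) => h _ _; apply: h.
  split=> [t St|| j].
  - by rewrite dsum; apply: sumr_ge0 => j _; apply: ge0.
  - by rewrite dsum big1 // => j _; case: (hy j).
  rewrite -dot_unitx dsum (bigD1 j) //= ltr_wpDr //.
    by apply: sumr_ge0 => i _; apply/ge0/S0.
  by rewrite dot_unitx; case: (hy j).
move=> j; apply: contrapT => ny.
have /choice[mu hmu] : forall o, exists mu : R, 0 <= mu /\
    cone [set hv t | t in rees (Eo o)] (mu *: hv s - hv (unitx j)).
  move=> o; have [[y [yE ys yj]]|[mu mu0 h]] := rees_facet j (S_Eo o Ss); last by exists mu.
  by case: ny; exists y; split=> // t St; apply: yE; apply: S_Eo.
(* One integer above all the [mu o]: the excess [(N - mu o) s] stays in each cone. *)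
pose N := (Num.truncn (\sum_o mu o)).+1.
have N_gt o : mu o <= N%:R.
  apply/ltW; apply: le_lt_trans (truncnS_gt _).
  rewrite (bigD1 o) //= lerDl; apply: sumr_ge0 => i _; by case: (hmu i).
have cN : cone [set hv t | t in S] ((N%:R : R) *: hv s - hv (unitx j)).
  apply: cone_S => o; have -> : N%:R *: hv s - hv (unitx j) =
     (N%:R - mu o) *: hv s + (mu o *: hv s - hv (unitx j)).
    by rewrite addrA -scalerDl subrK.
  apply: coneD; last by case: (hmu o).
  apply: coneZ; first by rewrite subr_ge0.
  by apply: cone_sub; exists s => //; apply: S_Eo.
(* The cone over [S] lies in the orthant, so the truncated subtraction defining [t] below is
   exact. *)
have le_j : (U_(j) <= s.1 *+ N)%MM.
  have := cone_hv_ge0 (lshift 1 j) cN.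
  rewrite -hvM mxE [in X in _ + X]mxE !homvL !mxE mnm1E eqxx subr_ge0 ler_nat lep1mP.
  by rewrite lt0n.
pose t := ((s.1 *+ N - U_(j))%MM, (s.2 * N)%N) : 'X_{1..n} * nat.
have te : addx (unitx j) t = mulx s N.
  by rewrite /addx /mulx /= addmC submK.
have ct : cone [set hv t | t in S] (hv t : 'rV[R]_(n + 1)).
  suff -> : hv t = N%:R *: hv s - hv (unitx j) :> 'rV[R]_(n + 1) by [].
  by rewrite -hvM -te hvD addrC addKr.
have [m m0 Sm] := cone_hv_mulx SS ct.
have Fm := fface_mulx m FF (fface_mulx N FF Fs).
(* One copy of [e_j] is split off from [m N s = m e_j + m t]; the cofactor is in [S], so the face
   property applies. *)
have e : mulx (mulx s N) m = addx (unitx j) (addx (mulx (unitx j) m.-1) (mulx t m)).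
  have mE : m%:R = 1 + m.-1%:R :> R by rewrite -mulrS prednK.
  apply: (@hv_inj R); rewrite hvM -te !hvD !hvM scalerDr {1}mE.
  by rewrite scalerDl scale1r -addrA.
have St' : S (addx (mulx (unitx j) m.-1) (mulx t m)).
  have [_ SD] := SS; apply: SD; last exact: Sm.
  by apply: (submonoid_mulx _ SS); apply: S0.
have [] := (ffaceD FF (S0 U_(j)%MM) St').1; first by rewrite -[addx _ _]e.
by move/(fface_unit FF).
Qed.

Lemma fiber_face_compact_face F r (s : 'I_r -> 'X_{1..n} * nat) : (0 < r)%N ->
    fiber_face S F -> (forall i, F (s i)) ->
    lin_indep (fun i => hv (s i) : 'rV[R]_(n + 1)) ->
  exists2 G, face P G /\ compact G &
    exists x : 'I_r -> 'rV[R]_n, (forall i, G (x i)) /\ aff_indep x.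
Proof.
move=> r0 FF Fs li.
have S0 a : S (a, 0%N) by apply: rees_family0.
have k0 i : (0 < (s i).2)%N.
  apply: fface_gt0 FF S0 (Fs i) _ => e.
  have : \sum_j (j == i)%:R *: hv (s j) = 0 :> 'rV[R]_(n + 1).
    rewrite (bigD1 i) //= e hv0 scaler0 add0r big1 // => j /negPf ->.
    by rewrite scale0r.
  by move=> /li/(_ i)/eqP; rewrite eqxx oner_eq0.
(* Supporting [F] at the sum of the [s i] suffices: nonnegative values with sum 0 all vanish. *)
pose t := \big[@addx n/zerox n]_(i <- enum 'I_r) s i.
have Ft : F t.
  rewrite /t; elim/big_ind: _ => [|a b Fa Fb|//]; first exact: fface0 FF.
  by apply/(ffaceD FF) => //; apply: fface_sub FF _ _.
have [y [yS yt yj]] := fiber_face_support FF Ft.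
have ys i : dot (hv (s i)) y = 0.
  have ge0 j : 0 <= dot (hv (s j)) y by apply/yS/(fface_sub FF).
  have /eqP := yt; rewrite hv_sum dotr_suml psumr_eq0 // => /allP/(_ i).
  by rewrite mem_enum => /(_ isT)/eqP.
pose c := lsubmx y; pose b := - y 0 (rshift n 0).
have dE v : dot (homv v 1) y = dot c v - b.
  by rewrite -{1}[y]homv_sub dot_homv mul1r dotC opprK.
have Pge v : P v -> b <= dot c v.
  move=> /family_polyhedron_cone-/(_ E_up) cv; rewrite -subr_ge0 -dE.
  by apply: cone_dot_ge0 cv => _ [a Sa <-]; apply: yS.
pose G := [set v | P v /\ dot c v = b].
have GP : face P G by exists c, b; split=> // v /Pge.
pose x i : 'rV[R]_n := ((s i).2%:R)^-1 *: vec (s i).1.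
have kn0 i : ((s i).2%:R : R) != 0 by rewrite pnatr_eq0 -lt0n.
have xE i : homv (x i) 1 = ((s i).2%:R)^-1 *: hv (s i).
  by rewrite /hv homvZ mulVf.
exists G; last first.
  exists x; split=> [i|w w0 wx i].
    split; last by apply/eqP; rewrite -subr_eq0 -dE xE dotZl ys mulr0.
    apply/family_polyhedron_cone => //; rewrite xE; apply: coneZ.
      by rewrite invr_ge0.
    by apply: cone_sub; exists (s i) => //; apply: (fface_sub FF).
  have : \sum_i (w i / (s i).2%:R) *: hv (s i) = 0 :> 'rV[R]_(n + 1).
    under eq_bigr => j _ do rewrite -scalerA -xE homvZ mulr1.
    have -> : \sum_j homv (w j *: x j) (w j) = homv (\sum_j w j *: x j) (\sum_j w j).
      elim/big_rec3: _ => [|j a b' d _ ->]; last by rewrite homvD.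
      by rewrite homv0.
    by rewrite w0 wx homv0.
  move=> /li/(_ i)/eqP; rewrite mulf_eq0 invr_eq0 (negPf (kn0 i)) orbF.
  by move=> /eqP.
split=> //; apply: bounded_closed_compact.
  (* On [G] the nonnegative terms [c_j v_j] add up to [b], so [v_j <= b / c_j]. *)
  exists (\sum_i `|b / c 0 i|); split; first exact: num_real.
  move=> M leM v [[v0 Pv] vb].
  apply/ltW; apply: le_lt_trans leM.
  have cj j : 0 < c 0 j by rewrite mxE.
  rewrite [leLHS]mx_normrE; apply: bigmax_le => [|[l j] _ /=].
    by apply: sumr_ge0.
  rewrite (ord1 l) ger0_norm // (bigD1 j) //=; apply: ler_wpDr.
    by apply: sumr_ge0.
  apply: le_trans (ler_norm _); rewrite ler_pdivlMr // mulrC -vb /dot (bigD1 j) //=.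
  rewrite lerDl; apply: sumr_ge0 => l' _; rewrite mulr_ge0 //; exact/ltW.
have -> : G = P `&` ((fun v : 'rV[R]_n => dot v c) @^-1` [set b]).
  by apply/seteqP; split=> v /= [Pv e]; split=> //; rewrite -?e dotC.
apply: closedI; first exact: closed_family_polyhedron.
by apply: closed_comp; [move=> v _; apply: dot_continuous|exact: closed_eq].
Qed.

(** The terms of the combination have nonnegative products with [y] and total 0, so a generator of
    nonzero weight is orthogonal to [y]. *)
Lemma cone_support d (Y : set 'rV[R]_d) (u y : 'rV[R]_d) :
    (forall a, Y a -> 0 <= dot a y) -> cone Y u -> dot u y = 0 ->
  cone [set a | Y a /\ dot a y = 0] u.
Proof.
move=> Yy [r hr ->]; rewrite dotr_suml big_seq => /eqP.
rewrite psumr_eq0 => [/allP h|q /hr[q0 /Yy qy]]; last by rewrite dotZl mulr_ge0.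
apply: cone_sum => q qr _; have [q0 Yq] := hr q qr.
have := h q qr; rewrite qr /= dotZl mulf_eq0 => /orP[/eqP->|/eqP qy].
  by rewrite scale0r; apply: cone0.
by apply: coneZ => //; apply: cone_sub.
Qed.

Lemma fiber_face_zero : fiber_face S [set @zerox n].
Proof.
have [S0 _] := rees_family_submonoid E.
split=> [_ ->|//|[a k] [b l] _ _|i /(congr1 fst)/eqP]; first exact: S0.
- split=> [e|[-> ->]]; last by rewrite /= add0x.
  have /eqP := congr1 fst e; have /eqP := congr1 snd e.
  rewrite /= addn_eq0 mnmD_eq0 => /andP[/eqP-> /eqP->] /andP[/eqP-> /eqP->].
  by [].
by rewrite mnm1_eq0.
Qed.

Lemma compact_face_fiber_face G m (x : 'I_m -> 'rV[R]_n) :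
    face P G -> compact G -> (forall i, G (x i)) -> aff_indep x ->
  exists2 F, fiber_face S F & exists s : 'I_m -> 'X_{1..n} * nat,
    (forall i, F (s i)) /\ lin_indep (fun i => hv (s i) : 'rV[R]_(n + 1)).
Proof.
(* With no points, [G] may be empty; the face reduced to zero serves. *)
case: m x => [|m] x.
  move=> _ _ _ _; exists [set zerox n]; first exact: fiber_face_zero.
  by exists (fun=> zerox n); split=> // ? ? [].
move=> [c [b [cP GE]]] /compact_bounded[M [_ hM]] Gx ai.
have GE' v : G v <-> P v /\ dot c v = b by rewrite GE.
have cP' v : P v -> b <= dot c v by exact: cP.
have [Pv0 v0b] := (GE' _).1 (Gx ord0); set v0 := x ord0 in Pv0 v0b.
have Pv0t j (t : R) : 0 <= t -> P (v0 + t *: delta_mx 0 j).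
  move=> t0; have [p1 p2] := Pv0; split=> [i|l].
    rewrite !mxE; apply: addr_ge0; first exact: p1.
    by rewrite mulr_ge0.
  by apply: newton_delta.
have dE j (t : R) : dot c (v0 + t *: delta_mx 0 j) = b + t * c 0 j.
  by rewrite dotDr v0b dotZr dotC dot_delta.
(* [c_j >= 0] since [P] contains [v0 + e_j]. If [c_j] were 0, the ray from [v0] in direction [e_j]
   would stay in [G]; its point at parameter [|M| + 2] exceeds the bound [|M| + 1]. *)
have cj j : 0 < c 0 j.
  rewrite lt_neqAle; apply/andP; split; last first.
    by have := cP' _ (Pv0t j 1 ler01); rewrite dE mul1r lerDl.
  apply/eqP => /esym c0.
  have Gt (t : R) : 0 <= t -> G (v0 + t *: delta_mx 0 j).
    by move=> t0; apply/GE'; split; [exact: Pv0t|rewrite dE c0 mulr0 addr0].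
  have M1 : M < `|M| + 1 by apply: le_lt_trans (ler_norm M) _; rewrite ltrDl.
  have t0 : 0 <= `|M| + 2 by rewrite addr_ge0.
  have le := hM _ M1 _ (Gt _ t0).
  have : `|(v0 + (`|M| + 2) *: delta_mx 0 j) 0 j| <= `|M| + 1.
    apply: le_trans le; rewrite [leRHS]mx_normrE.
    by apply: (le_bigmax _ (fun ij => `|(v0 + (`|M| + 2) *: delta_mx 0 j) ij.1 ij.2|) (0, j)).
  have v0j : 0 <= v0 0 j by case: Pv0 => h _; apply: h.
  rewrite !mxE !eqxx mulr1 ger0_norm ?addr_ge0 // => h.
  by move: v0j h; lra.
pose y := homv c (- b).
have yE v (t : R) : dot (homv v t) y = dot c v - t * b.
  by rewrite dot_homv dotC mulrN.
(* At height 0 this is positivity of [c]; at positive height, dividing by the height gives a point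
   of [P], where [c] is at least [b]. *)
have yS s : S s -> 0 <= dot (hv s) y.
  case: s => a [|k] Ss; rewrite /hv yE.
    rewrite mul0r subr0; apply: sumr_ge0 => i _; apply: mulr_ge0; first exact: ltW.
    by rewrite mxE.
  have k0 : 0 < k.+1%:R :> R by [].
  have : P (k.+1%:R^-1 *: vec a).
    apply/family_polyhedron_cone => //.
    have -> : homv (k.+1%:R^-1 *: vec a) 1 = (k.+1%:R : R)^-1 *: hv (a, k.+1).
      by rewrite /hv homvZ mulVf // gt_eqF.
    by apply: coneZ; [rewrite invr_ge0|apply: cone_sub; exists (a, k.+1)].
  move=> /cP'; rewrite dotZr subr_ge0 => h.
  by rewrite mulrC -ler_pdivlMr // mulrC.
pose F := [set s | S s /\ dot (hv s) y = 0].
have S0 a : S (a, 0%N) by apply: rees_family0.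
have [Sz SD] := rees_family_submonoid E.
exists F.
  split=> [s []//||s t Ss St|i [_]].
  - by split; [exact: Sz|rewrite hv0 dot0l].
  - split=> [[_ /eqP]|[[_ s0] [_ t0]]]; last first.
      by split; [exact: SD|rewrite hvD dotDl s0 t0 addr0].
    by rewrite hvD dotDl paddr_eq0 ?yS // => /andP[/eqP ? /eqP ?].
  by rewrite dot_unitx homvL => /eqP; rewrite gt_eqF.
(* The last coordinate of a linear relation at height 1 is the condition that the weights sum to
   0. *)
have li : lin_indep (fun i => homv (x i) 1).
  move=> w; have -> : \sum_j w j *: homv (x j) 1 = homv (\sum_j w j *: x j) (\sum_j w j).
    by elim/big_rec3: _ => [|j a b' d _ ->]; rewrite ?homv0 // homvZ homvD mulr1.
  move=> e; apply: ai.
    by have := congr1 (fun u : 'rV[R]_(n + 1) => u 0 (rshift n 0)) e; rewrite /= homvR mxE.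
  by have := congr1 (@lsubmx _ 1 n 1) e; rewrite row_mxKl linear0.
have cF i : cone [set hv s | s in F] (homv (x i) 1).
  have [Px xb] := (GE' _).1 (Gx i).
  have : cone [set a | [set hv s | s in S] a /\ dot a y = 0] (homv (x i) 1).
    apply: cone_support; last by rewrite yE xb mul1r subrr.
      by move=> _ [s Ss <-]; apply: yS.
    by have /family_polyhedron_cone := Px; apply.
  by apply: cone_mono => _ [[s Ss <-] s0]; exists s.
have [z [zF zli]] := lin_indep_cone li cF.
have /choice[s hs] : forall i, exists s, F s /\ hv s = z i.
  by move=> i; have [s Fs e] := zF i; exists s.
exists s; split=> [i|]; first by have [] := hs i.
suff -> : (fun i => hv (s i)) = z by [].
by apply/funext => i; have [] := hs i.
Qed.

End CompactFaces.

(** * Symbolic powers of monomial ideals *)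

Section MonomialIdeals.
Variables (k : fieldType) (n : nat).
Implicit Types (E : set 'X_{1..n}) (f g : {mpoly k[n]}) (a b : 'X_{1..n}) (W : {set 'I_n}).

Definition monomials_in E : set {mpoly k[n]} := [set f | forall a, a \in msupp f -> E a].

Lemma monomials_in0 E : monomials_in E 0.
Proof. by move=> a; rewrite msupp0. Qed.

Lemma monomials_inD E f g : monomials_in E f -> monomials_in E g -> monomials_in E (f + g).
Proof. by move=> hf hg a /msuppD_le; rewrite mem_cat => /orP[/hf|/hg]. Qed.

Lemma monomials_inX E a : monomials_in E 'X_[a] <-> E a.
Proof.
split=> [|Ea b]; first by apply; rewrite msuppX mem_head.
by rewrite msuppX inE => /eqP->.
Qed.

Lemma monomials_inM E f g : upset E -> monomials_in E g -> monomials_in E (f * g).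
Proof.
move=> Eup hg a /msuppM_le/allpairsP[[b c] /= [_ cg ->]].
by apply: Eup (hg c cg) _; apply: lem_addl.
Qed.

Lemma monomials_in_ind E (Q : set {mpoly k[n]}) :
    Q 0 -> (forall f g, Q f -> Q g -> Q (f + g)) ->
    (forall c a, E a -> Q (c *: 'X_[a])) ->
  monomials_in E `<=` Q.
Proof.
move=> Q0 QD QZ f hf; rewrite (mpolyE f) big_seq.
by elim/big_ind: _ => // a /hf; apply: QZ.
Qed.

Lemma ideal_gen_monomials (M : set 'X_{1..n}) :
  ideal_gen [set 'X_[m] | m in M] = monomials_in [set a | exists2 g, M g & (g <= a)%MM].
Proof.
have Eup : upset [set a | exists2 g, M g & (g <= a)%MM].
  by move=> a b [g Mg ga] ab; exists g => //; apply: lepm_trans ab.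
apply/seteqP; split=> f.
  move=> [s hs ->]; rewrite big_seq; elim/big_ind: _ => [|u v|q /hs[_ [m Mm <-]]].
  - exact: monomials_in0.
  - exact: monomials_inD.
  - apply: monomials_inM => //; apply/monomials_inX; exists m => //.
    exact: lepm_refl.
apply: monomials_in_ind => [|u v|c a [g Mg ga]]; [exact: lin_span0|exact: lin_spanD|].
rewrite -[a](submK ga) mpolyXD scalerAl; apply: ideal_genMl; apply: ideal_genP.
by exists g.
Qed.

Lemma ideal_pow_monomials E m : upset E ->
  ideal_pow (monomials_in E) m = monomials_in [set a | rees E (a, m)].
Proof.
move=> Eup.
have up_m l : upset [set a | rees E (a, l)].
  by move=> a b [g [gs gE ga]] ab; exists g; split=> //; apply: lepm_trans ab.
apply/seteqP; split=> f.
  move=> [s hs ->]; rewrite big_seq; elim/big_ind: _ => [|u v|q /hs[_ [F FE <-]]].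
  - exact: monomials_in0.
  - exact: monomials_inD.
  - apply: monomials_inM; first exact: up_m.
    suff /(_ (enum 'I_m)) : forall r : seq 'I_m,
        monomials_in [set a | rees E (a, size r)] (\prod_(i <- r) F i).
      by rewrite size_enum_ord big_enum.
    elim=> [|i r IH]; first by move=> a _; apply: rees0.
    rewrite big_cons => a /msuppM_le/allpairsP[[b c] /= [bF cP ->]].
    have [_ RD] := rees_submonoid E.
    by have := RD _ _ (rees1 (FE i b bF)) (IH c cP).
apply: monomials_in_ind => [|u v|c a [g [/= gs gE ga]]]; [exact: lin_span0|exact: lin_spanD|].
rewrite -[a](submK ga) mpolyXD scalerAl; apply: ideal_genMl; apply: ideal_genP.
exists (fun i : 'I_m => 'X_[nth 0%MM g i]) => [i|].
  by apply/monomials_inX; apply: gE; rewrite mem_nth // gs.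
by rewrite -mpolyX_prod (big_nth 0%MM) gs big_mkord.
Qed.

Definition off W a := forall i, i \in W -> a i = 0%N.

(** The exponents of the ideal obtained by inverting the variables outside [W] and contracting back;
    [u] is the exponent of a denominator. *)
Definition local_exps W E : set 'X_{1..n} := [set a | exists2 u, off W u & E (a + u)%MM].

Lemma off0 W : off W 0%MM.
Proof. by move=> i _; rewrite mnm0E. Qed.

Lemma offD W a b : off W a -> off W b -> off W (a + b)%MM.
Proof. by move=> ha hb i iW; rewrite mnmDE ha ?hb. Qed.

Lemma local_exps_upset W E : upset E -> upset (local_exps W E).
Proof.
move=> Eup a b [u uW Eau] ab; exists u => //; apply: Eup Eau _.
by apply: lepm_add => //; apply: lepm_refl.
Qed.

Lemma local_exps_sub W E : E `<=` local_exps W E.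
Proof. by move=> a Ea; exists 0%MM; [exact: off0|rewrite addm0]. Qed.

Lemma local_exps_mono W W' E : W \subset W' -> local_exps W' E `<=` local_exps W E.
Proof. by move=> /fintype.subsetP WW' a [u uW Eu]; exists u => // i /WW'/uW. Qed.

Lemma rees_mono E E' : E `<=` E' -> @rees n E `<=` rees E'.
Proof. by move=> EE s [g [gs gE gl]]; exists g; split=> // x /gE/EE. Qed.

(** Powers commute with localization. The variables outside [W] are units, so [rst] erases them from
    each factor; conversely, the denominators of the factors are multiplied together. *)
Lemma rees_local_exps W E a m : upset E ->
  local_exps W [set b | rees E (b, m)] a <-> rees (local_exps W E) (a, m).
Proof.
move=> Eup; split.
  move=> [u uW [g [/= gs gE ga]]].
  pose rst b : 'X_{1..n} := [multinom if i \in W then b i else 0%N | i < n].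
  exists (map rst g); split; first by rewrite size_map.
    move=> _ /mapP[b bg ->]; exists (b - rst b)%MM.
      by move=> i iW; rewrite mnmBE mnmE iW subnn.
    rewrite addmC submK; first exact: gE.
    by apply/mnm_lepP => i; rewrite mnmE; case: ifP.
  apply/mnm_lepP => i; rewrite big_map mnm_sumE.
  have [iW|iW] := boolP (i \in W); last first.
    by rewrite big1 // => b _; rewrite mnmE (negPf iW).
  have /mnm_lepP/(_ i) := ga; rewrite mnm_sumE mnmDE uW // addn0.
  by under [in X in _ -> X]eq_bigr => b _ do rewrite mnmE iW.
move=> [g [/= gs gE ga]].
have /choice[u hu] : forall b, exists u, b \in g -> off W u /\ E (b + u)%MM.
  move=> b; have [/gE[u uW Eu]|nb] := boolP (b \in g); first by exists u.
  by exists 0%MM.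
exists (\sum_(b <- g) u b)%MM.
  rewrite big_seq; elim/big_ind: _ => [|x y|b /hu[]//]; [exact: off0|exact: offD].
exists [seq (b + u b)%MM | b <- g]; split; first by rewrite size_map.
  by move=> _ /mapP[b /hu[_ Eb] ->].
by rewrite big_map big_split; apply: lepm_add => //; apply: lepm_refl.
Qed.

Lemma seq_min (d : Order.disp_t) (T : orderType d) (s : seq T) (P : pred T) :
  has P s -> exists x, [/\ x \in s, P x & forall y, y \in s -> P y -> (x <= y)%O].
Proof.
elim: s => // x s IH /=; have [Ps|nPs] := boolP (has P s).
  move=> _; have [y [ys Py ymin]] := IH Ps.
  have [Px|nPx] := boolP (P x); last first.
    exists y; rewrite inE ys orbT; split=> // z; rewrite inE => /orP[/eqP->|/ymin//].
    by rewrite (negPf nPx).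
  have [xy|yx] := leP x y.
    exists x; rewrite mem_head; split=> // z; rewrite inE => /orP[/eqP->//|zs Pz].
    by apply: le_trans xy _; apply: ymin.
  exists y; rewrite inE ys orbT; split=> // z; rewrite inE => /orP[/eqP->|/ymin//] _.
  exact: ltW.
rewrite orbF => Px; exists x; rewrite mem_head; split=> // z.
rewrite inE => /orP[/eqP->//|zs Pz]; case/negP: nPs.
by apply/hasP; exists z.
Qed.

(* Among the monomials of [f] outside [E], and those of [s] prime to [W], take
   the least ones, comparing degrees in the variables of [W] first: their
   product survives in [s * f]. *)
Lemma monomials_in_saturated W E s f b :
    upset E -> (forall a u, off W u -> E (a + u)%MM -> E a) ->
    b \in msupp s -> off W b -> monomials_in E (s * f) ->
  monomials_in E f.
Proof.
move=> Eup Esat bs bW hsf a0 a0f; apply: contrapT => nEa0.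
pose w a := (\sum_(i in W) a i)%N.
have wD a c : w (a + c)%MM = (w a + w c)%N.
  by rewrite /w -big_split; apply: eq_bigr => i _; rewrite mnmDE.
have w0 a : off W a -> w a = 0%N by move=> aW; rewrite /w big1.
have off_w a : w a = 0%N -> off W a.
  move=> /eqP; rewrite /w sum_nat_eq0 => /forallP h i iW.
  by have := h i; rewrite iW => /eqP.
have [m1 [m1s m1W m1min]] : exists m1, [/\ m1 \in msupp s, w m1 == 0%N &
    forall y, y \in msupp s -> w y == 0%N -> (m1 <= y)%O].
  by apply: seq_min; apply/hasP; exists b => //; rewrite w0.
pose N := [pred a | (a \in msupp f) && ~~ `[< E a >]].
have exN : exists l, has (fun a => N a && (w a == l)) (msupp f).
  exists (w a0); apply/hasP; exists a0 => //=; rewrite a0f eqxx andbT.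
  by apply/negP => /asboolP.
have [l lN lmin] := ex_minnP exN.
have [m2 [m2f /andP[/andP[_ m2E] /eqP m2w] m2min]] := seq_min lN.
have nEm : ~ E (m1 + m2)%MM.
  rewrite addmC => /Esat h; move/negP: m2E; apply; apply/asboolP; apply: h.
  by apply: off_w; apply/eqP.
suff : (s * f)@_(m1 + m2)%MM != 0 by rewrite -mcoeff_msupp => /hsf.
pose D := (mdeg (m1 + m2)%MM).+1.
have d1 : (mdeg m1 < D)%N by rewrite ltnS mdegD leq_addr.
have d2 : (mdeg m2 < D)%N by rewrite ltnS mdegD leq_addl.
rewrite mcoeffM (bigD1 (BMultinom d1, BMultinom d2)) //= big1 ?addr0.
  by rewrite mulf_neq0 // -mcoeff_msupp.
(* Suppose [c1 + c2 = m1 + m2]. Then [c2] is outside [E], as the sum is, so its degree in [W] is at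
   least [l]. Equality of total degrees in [W] makes [c1] and [c2] competitors in the two
   minimizations, and the monomial order forces both equalities. *)
move=> [[c1 c1D] [c2 c2D]] /= /andP[/eqP e ne].
apply/eqP; rewrite mulf_eq0 !mcoeff_eq0 -negb_and; apply: contra ne => /andP[c1s c2f].
have Nc2 : N c2.
  rewrite /= c2f; apply/negP => /asboolP Ec2; apply: nEm; rewrite e.
  by apply: Eup Ec2 _; apply: lem_addl.
have wl : (l <= w c2)%N.
  by apply: lmin; apply/hasP; exists c2 => //; rewrite Nc2 eqxx.
have /eqP : w (m1 + m2)%MM = w (c1 + c2)%MM by rewrite e.
rewrite !wD (eqP m1W) m2w => /eqP wE.
have wc1 : w c1 == 0%N by apply/eqP; lia.
have wc2 : w c2 == l by apply/eqP; lia.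
have le1 := m1min c1 c1s wc1.
have le2 : (m2 <= c2)%O by apply: m2min => //; rewrite Nc2.
have e1 : m1 = c1.
  apply/eqP; rewrite eq_le le1 /= leNgt; apply/negP => lt1.
  by have := ltmc_le_add lt1 le2; rewrite e ltxx.
have e2 : m2 = c2 by move: e; rewrite e1 => /addmI.
by apply/eqP; congr (_, _); apply: val_inj; rewrite /= ?e1 ?e2.
Qed.

Implicit Types (p q : prime_idealr {mpoly k[n]}).

Definition varset p : {set 'I_n} := [set i | ('X_i : {mpoly k[n]}) \in p].

Lemma mpolyX_prime p a : ('X_[a] : {mpoly k[n]}) \in p -> ~ off (varset p) a.
Proof.
rewrite mpolyXE_id => pa aW; move: pa; apply/negP.
elim/big_ind: _ => [|x y|i _]; first by rewrite idealr1.
  by rewrite prime_idealrM negb_or => -> ->.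
have [/aW->|iW] := boolP (i \in varset p); first by rewrite expr0 idealr1.
elim: (a i) => [|l IH]; first by rewrite expr0 idealr1.
by rewrite exprS prime_idealrM negb_or IH andbT; rewrite inE in iW.
Qed.

Lemma mpolyX_off p a : off (varset p) a -> ('X_[a] : {mpoly k[n]}) \notin p.
Proof. by move=> aW; apply/negP => /mpolyX_prime. Qed.

Lemma exists_off_monomial p (s : {mpoly k[n]}) : s \notin p ->
  exists2 b, b \in msupp s & off (varset p) b.
Proof.
move=> sp; apply: contrapT => h; case/negP: sp.
rewrite (mpolyE s) big_seq; apply: rpred_sum => b bs.
have [i iW bi] : exists2 i, i \in varset p & b i <> 0%N.
  apply: contrapT => h'; apply: h; exists b => // i iW.
  by apply: contrapT => bi; apply: h'; exists i.
have ib : (U_(i) <= b)%MM by rewrite lep1mP; apply/eqP.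
rewrite -[b](submK ib) mpolyXD scalerAl; apply: idealMr.
by rewrite inE in iW.
Qed.

Lemma loc_contraction_frac (I : set {mpoly k[n]}) p f :
    I 0 -> (forall x y, I x -> I y -> I (x + y)) -> (forall x y, I y -> I (x * y)) ->
  loc_contraction I p f -> exists2 s, s \notin p & I (s * f).
Proof.
move=> I0 ID IM [r hr e].
suff [s sp [j Ij ej]] : exists2 s, s \notin p & exists2 j, I j & tofrac s * tofrac f = tofrac j.
  exists s => //; suff -> : s * f = j by [].
  by apply/eqP; rewrite -tofrac_eq tofracM ej.
rewrite e big_seq; elim/big_ind: _ => [|u v|q /hr[[a [s [sp e1]]] [j Ij e2]]].
- by exists 1; [rewrite idealr1|exists 0; rewrite ?mulr0 ?tofrac0].
- move=> [s sp [j Ij ej]] [s' sp' [j' Ij' ej']]; exists (s * s').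
    by rewrite prime_idealrM negb_or sp.
  exists (s' * j + s * j'); first by apply: ID; apply: IM.
  by rewrite tofracD !tofracM -ej -ej' mulrDr; congr (_ + _); rewrite mulrA // [X in X * _]mulrC.
- exists s => //; exists (a * j); first exact: IM.
  rewrite e1 -e2 tofracM mulrA mulrCA divff ?mulr1 // tofrac_eq0.
  by apply: contraNneq sp => ->; apply: rpred0.
Qed.

(** A denominator outside [p] has a monomial without variables of [p], and [local_exps] is saturated
    for such elements by [monomials_in_saturated]. Conversely the monomials in the other variables
    are themselves outside [p]. *)
Lemma loc_contraction_monomials E p : upset E ->
  loc_contraction (monomials_in E) p = monomials_in (local_exps (varset p) E).
Proof.
move=> Eup; apply/seteqP; split=> f.
  move=> floc; have [s /exists_off_monomial[b bs bW] Isf] := loc_contraction_frac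
    (@monomials_in0 E) (@monomials_inD E) (fun x y => @monomials_inM E x y Eup) floc.
  apply: (monomials_in_saturated _ _ bs bW) => [|a u uW [v vW Ev]|a /Isf].
  - exact: local_exps_upset.
  - by exists (u + v)%MM; [exact: offD|rewrite addmA].
  exact: local_exps_sub.
apply: monomials_in_ind => [|u v|c a [u uW Eau]]; rewrite /loc_contraction /=.
- by rewrite tofrac0; apply: lin_span0.
- by rewrite tofracD; apply: lin_spanD.
exists [:: (tofrac c%:MP / tofrac 'X_[u], tofrac 'X_[a + u])].
  move=> q; rewrite inE => /eqP-> /=; split.
    by exists c%:MP, 'X_[u]; split=> //; apply: mpolyX_off.
  by exists 'X_[a + u] => //; apply/monomials_inX.
rewrite big_seq1 /= -mul_mpolyC mpolyXD !tofracM mulrAC -mulrA -mulrA divff ?mulr1 //.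
rewrite tofrac_eq0; apply: contraNneq (mpolyX_off uW) => ->; exact: rpred0.
Qed.

(** This amounts to [p] being generated by variables. Let [p] be the annihilator of [f] modulo the
    ideal. If [b] avoided the variables of [p], saturation by [g] would put [f] in the localized
    ideal; a product ['X_[U]] of denominators would then annihilate [f], so lie in [p], although it
    avoids the variables of [p]. *)
Lemma Ass_monomials E p g b : upset E -> Ass (monomials_in E) p -> g \in p ->
  b \in msupp g -> ~ off (varset p) b.
Proof.
move=> Eup [f hf] gp bg bW.
have : monomials_in (local_exps (varset p) E) f.
  apply: (monomials_in_saturated _ _ bg bW) => [|a u uW [v vW Ev]|a].
  - exact: local_exps_upset.
  - by exists (u + v)%MM; [exact: offD|rewrite addmA].
  by move: gp => /hf h /h; apply: local_exps_sub.
move=> floc; have /choice[u hu] : forall a, exists u, a \in msupp f ->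
    off (varset p) u /\ E (a + u)%MM.
  move=> a; have [/floc[u uW Eu]|na] := boolP (a \in msupp f); first by exists u.
  by exists 0%MM.
pose U := (\sum_(a <- msupp f) u a)%MM.
have UW : off (varset p) U.
  by rewrite /U big_seq; elim/big_ind: _ => [|x y|a /hu[]//]; [exact: off0|exact: offD].
suff /hf/mpolyX_prime : monomials_in E ('X_[U] * f) by [].
move=> _ /msuppM_le/allpairsP[[c a] /= [+ af ->]].
rewrite msuppX inE => /eqP->; have [_ Ea] := hu a af; apply: Eup Ea _.
rewrite addmC; apply: lepm_add; last exact: lepm_refl.
rewrite /U (perm_big _ (perm_to_rem af)) big_cons; exact: lem_addr.
Qed.

Lemma Ass_sub E p q : upset E -> Ass (monomials_in E) p ->
  varset p \subset varset q -> {subset p <= q}.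
Proof.
move=> Eup Ap /fintype.subsetP pq g gp; apply: contraT => /exists_off_monomial[b bg bW].
by case: (Ass_monomials Eup Ap gp bg) => i /pq/bW.
Qed.

Lemma sub_varset p q : {subset p <= q} -> varset p \subset varset q.
Proof. by move=> pq; apply/fintype.subsetP => i; rewrite !inE => /pq. Qed.

(** A strict inclusion of associated primes adds a variable, so ascending stops within [n] steps. *)
Lemma sub_maxAss E p : upset E -> Ass (monomials_in E) p ->
  exists2 q, maxAss (monomials_in E) q & {subset p <= q}.
Proof.
move=> Eup; have [l] := ubnP (n - #|varset p|); elim: l => // l IH in p *.
move=> lt Ap; have [mp|nmp] := pselect (maxAss (monomials_in E) p); first by exists p.
have [q Aq [pq nqp]] : exists2 q, Ass (monomials_in E) q & {subset p <= q} /\ ~ {subset q <= p}.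
  apply: contrapT => h; apply: nmp; split=> // q Aq pq; apply: contrapT => nqp.
  by apply: h; exists q.
have lt_pq : (#|varset p| < #|varset q|)%N.
  apply: proper_card; rewrite properE sub_varset //=; apply/negP => qp.
  exact: (nqp (Ass_sub Eup Aq qp)).
have le_n : (#|varset q| <= n)%N by rewrite -[leqRHS]card_ord max_card.
have [|//|r mr qr] := IH q; first by lia.
by exists r => // x /pq/qr.
Qed.

(** * Symbolic powers and symbolic polyhedron through one family of exponent sets *)

Section SymbolicData.
Variable E : set 'X_{1..n}.
Hypothesis Eup : upset E.
Let I := monomials_in E.

(* The default [setT] is harmless: its Newton polyhedron is the orthant. *)
Definition maxAss_exps (W : {set 'I_n}) : set 'X_{1..n} :=
  if `[< exists2 p, maxAss I p & W = varset p >] then local_exps W E else setT.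

Lemma maxAss_exps_upset W : upset (maxAss_exps W).
Proof. by rewrite /maxAss_exps; case: asboolP => // _; apply: local_exps_upset. Qed.

(** Each localized power is the Rees monoid of the localized exponents. Maximal associated primes
    suffice: if [q] contains [p], localizing at [q] inverts fewer variables and gives the stronger
    condition. *)
Lemma symbolic_power_monomials m f :
  symbolic_power I m f <-> forall a, a \in msupp f -> rees_family maxAss_exps (a, m).
Proof.
case: m => [|m]; first by split=> // _ a _; apply: rees_family0.
have up_m : upset [set a | rees E (a, m.+1)].
  by move=> a b [g [gs gE ga]] ab; exists g; split=> //; apply: lepm_trans ab.
have locE p : loc_contraction (ideal_pow I m.+1) p f <->
    forall a, a \in msupp f -> rees (local_exps (varset p) E) (a, m.+1).
  rewrite /I ideal_pow_monomials // loc_contraction_monomials //.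
  by split=> h a /h /(rees_local_exps _ _ _ Eup).
split=> [h a af W|h p Ap].
  rewrite /maxAss_exps; case: asboolP => [[p [Ap _] ->]|_]; last exact: reesT.
  by apply: (locE p).1 a af; apply: h.
have [q mq pq] := sub_maxAss Eup Ap; apply/locE => a af.
apply: (@rees_mono (local_exps (varset q) E)); first exact/local_exps_mono/sub_varset.
have := h a af (varset q); rewrite /maxAss_exps; case: asboolP => // [[]].
by exists q.
Qed.

Lemma symbolic_polyhedron_monomials (R : realType) :
  symbolic_polyhedron R I = family_polyhedron R maxAss_exps.
Proof.
have newtonE p : Newton_polyhedron R (loc_contraction I p) = newton R (local_exps (varset p) E).
  rewrite /Newton_polyhedron /newton /I loc_contraction_monomials //.
  by congr (smallest _ (_ @` _)); apply/seteqP; split=> a /monomials_inX.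
apply/seteqP; split=> v [v0 hv]; split=> //.
  move=> W; rewrite /maxAss_exps; case: asboolP => [[p mp ->]|_].
    by rewrite -newtonE; apply: hv.
  rewrite -[v]add0r; apply: newton_up => //.
  have -> : 0 = vec 0%MM :> 'rV[R]_n by apply/rowP => i; rewrite !mxE mnm0E.
  exact: newton_vec.
move=> p mp; rewrite newtonE; have := hv (varset p); rewrite /maxAss_exps; case: asboolP => // [[]].
by exists p.
Qed.

End SymbolicData.

End MonomialIdeals.

(** * Algebraic independence along chains of primes *)

Section ChainIndependence.
Variable A : comNzRingType.

(* The lowest power of [f 0] is factored out of the sum, leaving, modulo the
   next prime of the chain, a sum in one variable less. *)
Lemma chain_independent m (c : nat -> prime_idealr A) (f : nat -> A)
    (T : finType) (D : pred T) (u : T -> A) (e : T -> nat -> nat) :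
    (forall i, (i < m)%N -> [/\ {subset c i <= c i.+1}, f i \in c i.+1 & f i \notin c i]) ->
    (forall t (p : prime_idealr A), D t -> u t \notin p) ->
    (forall s t, D s -> D t -> (forall i, (i < m)%N -> e s i = e t i) -> s = t) ->
    (exists t, D t) ->
  \sum_(t | D t) u t * \prod_(i < m) f i ^+ e t i \notin c 0%N.
Proof.
elim: m c f D e => [|m IH] c f D e cf uD eD [t0 Dt0].
  rewrite (big_pred1 t0) => [|t]; first by rewrite big_ord0 mulr1; apply: uD.
  by apply/idP/eqP => [Dt|->//]; apply: eD.
have exl : exists l, [exists t, D t && (e t 0%N == l)].
  by exists (e t0 0%N); apply/existsP; exists t0; rewrite Dt0 eqxx.
have [l /existsP[t1 /andP[Dt1 /eqP et1]] lmin] := ex_minnP exl.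
have le_l t : D t -> (l <= e t 0%N)%N.
  by move=> Dt; apply: lmin; apply/existsP; exists t; rewrite Dt eqxx.
have [c01 f1 f0] := cf 0%N isT.
pose B := \sum_(t | D t) u t * (f 0%N ^+ (e t 0%N - l) * \prod_(i < m) f i.+1 ^+ e t i.+1).
have -> : \sum_(t | D t) u t * \prod_(i < m.+1) f i ^+ e t i = f 0%N ^+ l * B.
  rewrite mulr_sumr; apply: eq_bigr => t Dt.
  rewrite big_ord_recl /= -{1}(subnKC (le_l t Dt)) exprD -mulrA mulrCA.
  by [].
rewrite prime_idealrM negb_or; apply/andP; split.
  elim: l {exl et1 lmin le_l B} => [|l IHl]; first by rewrite expr0 idealr1.
  by rewrite exprS prime_idealrM negb_or f0.
apply/negP => /c01; rewrite /B (bigID (fun t => e t 0%N == l)) /=.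
rewrite rpredDr; last first.
  apply: rpred_sum => t /andP[Dt tl]; apply: idealMr.
  have : (0 < e t 0%N - l)%N by rewrite subn_gt0 ltn_neqAle eq_sym tl le_l.
  by case: (_ - l)%N => // d _; rewrite exprS -mulrA mulrC; apply: idealMr.
apply/negP.
under eq_bigr => t /andP[_ /eqP->] do rewrite subnn expr0 mul1r.
apply: (IH (fun i => c i.+1) (fun i => f i.+1) _ (fun t i => e t i.+1)).
- by move=> i im; apply: cf.
- by move=> t p /andP[Dt _]; apply: uD.
- move=> s t /andP[Ds /eqP es] /andP[Dt /eqP et] est; apply: eD => // -[|i] im.
    by rewrite es et.
  exact: est.
- by exists t1; rewrite Dt1 et1 eqxx.
Qed.

End ChainIndependence.

(** * Algebraic dependence of more than r polynomials in r variables *)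

Section AlgebraicDependence.
Variables (k : fieldType) (r : nat).

Definition deg_le d (p : {mpoly k[r]}) := forall a, a \in msupp p -> (mdeg a <= d)%N.

Lemma deg_leM d e p q : deg_le d p -> deg_le e q -> deg_le (d + e) (p * q).
Proof.
move=> hp hq a /msuppM_le/allpairsP[[b c] /= [/hp hb /hq hc ->]].
by rewrite mdegD leq_add.
Qed.

Lemma deg_leX d p l : deg_le d p -> deg_le (l * d) (p ^+ l).
Proof.
move=> hp; elim: l => [|l IH]; last by rewrite exprS mulSn; apply: deg_leM.
by move=> a; rewrite expr0 msupp1 inE => /eqP->; rewrite mdeg0.
Qed.

Lemma deg_le_prod m d (f : 'I_m -> {mpoly k[r]}) :
  (forall i, deg_le d (f i)) -> deg_le (m * d) (\prod_i f i).
Proof.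
move=> hf; suff /(_ (enum 'I_m)) : forall s, deg_le (size s * d) (\prod_(i <- s) f i).
  by rewrite size_enum_ord big_enum.
elim=> [|i s IH]; last by rewrite big_cons mulSn; apply: deg_leM.
by move=> a; rewrite big_nil msupp1 inE => /eqP->; rewrite mdeg0.
Qed.

Lemma left_kernel p q (M : 'M[k]_(p, q)) : (q < p)%N -> exists2 v : 'rV_p, v != 0 & v *m M = 0.
Proof.
move=> qp; exists (nz_row (kermx M)); last by apply/sub_kermxP/nz_row_sub.
rewrite nz_row_eq0 kermx_eq0; apply/negP => /eqP e.
by have := rank_leq_col M; rewrite e leqNgt qp.
Qed.

(* There are N ^ m products of powers < N, in a space of polynomials whose
   dimension grows like N ^ r. *)
Lemma mpoly_dependent m (f : 'I_m -> {mpoly k[r]}) : (r < m)%N ->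
  exists N (c : {ffun 'I_m -> 'I_N} -> k), (exists e, c e != 0) /\
    \sum_e c e *: \prod_i f i ^+ e i = 0.
Proof.
move=> rm; pose d := (\max_i msize (f i))%N.
have fd i : deg_le d (f i).
  move=> a /msize_mdeg_lt/ltnW h; apply: leq_trans h _.
  exact: (@leq_bigmax _ (fun i => msize (f i)) i).
(* The products have degree at most [m N d < B], and [B <= N K]. Hence [B ^ r <= N ^ r * K ^ r < N ^
   r.+1 <= N ^ m], the strict inequality being the choice [N > K ^ r]. *)
pose K := (m * d).+1; pose N := (K ^ r).+1; pose B := (m * (N * d)).+1.
exists N; pose g (e : {ffun 'I_m -> 'I_N}) := \prod_i f i ^+ e i.
have gd e : deg_le (m * (N * d)) (g e).
  apply: deg_le_prod => i a /(deg_leX (fd i)) h; apply: leq_trans h _.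
  by rewrite leq_mul2r ltnW ?orbT.
have card_lt : (#|{ffun 'I_r -> 'I_B}| < #|{ffun 'I_m -> 'I_N}|)%N.
  rewrite !card_ffun !card_ord.
  have le_B : (B <= N * K)%N by rewrite /B /K mulnS mulnCA addnC -addn1 leq_add2l.
  apply: (@leq_ltn_trans (N ^ r * K ^ r)).
    by rewrite -expnMn; case: (r) => // r'; rewrite leq_exp2r.
  apply: (@leq_trans (N ^ r.+1)); last by rewrite leq_pexp2l.
  by rewrite expnSr ltn_pmul2l ?expn_gt0 // ltnS.
pose M : 'M[k]_(#|{ffun 'I_m -> 'I_N}|, #|{ffun 'I_r -> 'I_B}|) :=
  \matrix_(i, j)
    (g (enum_val i))@_[multinom (enum_val j : {ffun 'I_r -> 'I_B}) l : nat | l < r].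
have [v v0 vM] := left_kernel M card_lt.
exists (fun e => v 0 (enum_rank e)); split.
  have [i vi] : exists i, v 0 i != 0.
    apply: contrapT => h; case/eqP: v0; apply/rowP => i; rewrite mxE.
    by apply: contrapT => vi; apply: h; exists i; apply/eqP.
  by exists (enum_val i); rewrite enum_valK.
apply/mpolyP => u; rewrite mcoeff0 raddf_sum /=.
under eq_bigr do rewrite mcoeffZ.
have [uB|] := boolP [forall l, u l < B]%N; last first.
  rewrite negb_forall => /existsP[l]; rewrite -leqNgt => uB.
  rewrite big1 // => e _; have [ue|ue] := boolP (u \in msupp (g e)); last first.
    by rewrite (memN_msupp_eq0 ue) mulr0.
  have := gd e u ue; rewrite mdegE (bigD1 l) //= => h.
  by have := leq_trans uB (leq_trans (leq_addr _ _) h); rewrite ltnn.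
pose j := enum_rank [ffun l => Ordinal (forallP uB l)].
have := congr1 (fun w : 'rV_ _ => w 0 j) vM; rewrite !mxE => sum0; rewrite -[RHS]sum0.
rewrite (reindex (@enum_val _ predT)) /=; last first.
  by apply: onW_bij; apply: (Bijective (@enum_valK _) (@enum_rankK _)).
apply: eq_bigr => i _; rewrite enum_valK mxE; congr (_ * _).
by congr (_ @_ _); apply/mnmP => l; rewrite mnmE enum_rankK ffunE.
Qed.

End AlgebraicDependence.

(** * Primes of a quotient as kernels of maps to domains *)

Section QuotientPrimes.
Variables (A : comNzRingType) (I : idealr A) (D : idomainType) (g : {rmorphism A -> D}).
Hypothesis gI : forall x, x \in I -> g x = 0.

(** The kernel of the map induced by [g] on the quotient, read off on representatives; [gI] makes
    the choice irrelevant. *)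
Definition quot_kernel : {pred {ideal_quot I}} := fun z => g (repr z) == 0.

Lemma quot_kernel_pi x : (\pi_({ideal_quot I}) x \in quot_kernel) = (g x == 0).
Proof.
rewrite /quot_kernel unfold_in.
have /gI : repr (\pi_({ideal_quot I}) x) - x \in I.
  by rewrite Quotient.idealrBE reprK.
by rewrite rmorphB => /eqP; rewrite subr_eq0 => /eqP ->.
Qed.

Lemma quot_kernel_idealr : idealr_closed quot_kernel.
Proof.
split.
- by rewrite -(rmorph0 (\pi_({ideal_quot I}))) quot_kernel_pi rmorph0.
- by rewrite -(rmorph1 (\pi_({ideal_quot I}))) quot_kernel_pi rmorph1 oner_eq0.
move=> a u v; rewrite -[a]reprK -[u]reprK -[v]reprK -rmorphM -rmorphD !quot_kernel_pi.
by move=> /eqP hu /eqP hv; rewrite rmorphD rmorphM hu hv mulr0 addr0.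
Qed.

Lemma quot_kernel_prime : prime_idealr_closed quot_kernel.
Proof.
move=> u v; rewrite -[u]reprK -[v]reprK -rmorphM !quot_kernel_pi rmorphM.
by rewrite mulf_eq0.
Qed.

Lemma quot_prime : exists p : prime_idealr {ideal_quot I},
  forall x, (\pi_({ideal_quot I}) x \in p) = (g x == 0).
Proof.
pose p : prime_idealr {ideal_quot I} := HB.pack_for (PrimeIdealr.type {ideal_quot I})
  (quot_kernel : _ -> bool) (isIdealr.Build _ _ quot_kernel_idealr)
  (isPrimeIdealrClosed.Build _ _ quot_kernel_prime).
by exists p => x; apply: quot_kernel_pi.
Qed.

End QuotientPrimes.

(** * Primes of the symbolic fiber ring *)

Section BigradedPolynomials.
Variables (k : fieldType) (n : nat).
Implicit Types (F G : {poly {mpoly k[n]}}) (s t : 'X_{1..n} * nat) (S : set ('X_{1..n} * nat)).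

Definition bimonomial (c : k) s : {poly {mpoly k[n]}} := (c *: 'X_[s.1]) *: 'X^(s.2).

Definition supported S F := forall s, s.1 \in msupp F`_s.2 -> S s.

Lemma coef_bimonomial c s t : (bimonomial c s)`_t.2@_t.1 = c * (s == t)%:R.
Proof.
rewrite coefZ coefXn /=; have [e|e] := eqVneq t.2 s.2; last first.
  rewrite mulr0 mcoeff0 [s == t](_ : _ = false) ?mulr0 //.
  by apply/negP => /eqP st; rewrite st eqxx in e.
rewrite mulr1 mcoeffZ mcoeffX; congr (_ * _%:R).
by case: s t e => a i [b j] /= <-; rewrite xpair_eqE eqxx andbT.
Qed.

Lemma supported_bimonomial S c s : S s -> supported S (bimonomial c s).
Proof.
move=> Ss t; rewrite mcoeff_msupp coef_bimonomial.
by have [<-|] := eqVneq s t; rewrite ?mulr0 ?eqxx.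
Qed.

Lemma bimonomialM c d s t :
  bimonomial c s * bimonomial d t = bimonomial (c * d) (addx s t).
Proof.
rewrite /bimonomial -scalerAl -scalerAr scalerA -exprD /=; congr (_ *: _).
by rewrite -scalerAl -scalerAr scalerA mpolyXD.
Qed.

Lemma supported_ind S (Q : set {poly {mpoly k[n]}}) :
    Q 0 -> (forall F G, Q F -> Q G -> Q (F + G)) ->
    (forall c s, c != 0 -> S s -> Q (bimonomial c s)) ->
  forall F, supported S F -> Q F.
Proof.
move=> Q0 QD QM F SF.
have -> : F = \sum_(i < size F) F`_i *: 'X^i by rewrite -poly_def coefK.
elim/big_ind: _ => // i _.
rewrite {1}(mpolyE F`_i) scaler_suml big_seq.
elim/big_ind: _ => // a ai; apply: (QM _ (a, nat_of_ord i)).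
  by rewrite -mcoeff_msupp.
exact: SF.
Qed.

Variable r : nat.
Definition mlift (h : 'X_{1..n} -> {mpoly k[r]}) (p : {mpoly k[n]}) : {mpoly k[r]} :=
  \sum_(a <- msupp p) p@_a *: h a.

Lemma mlift_sub h (p : {mpoly k[n]}) (l : seq 'X_{1..n}) :
  uniq l -> {subset msupp p <= l} -> mlift h p = \sum_(a <- l) p@_a *: h a.
Proof.
move=> ul pl; rewrite [RHS](bigID (fun a => a \in msupp p)) /= [X in _ + X]big1 ?addr0; last first.
  by move=> a /memN_msupp_eq0 ->; rewrite scale0r.
rewrite -big_filter; apply: perm_big; apply: uniq_perm.
- exact: msupp_uniq.
- exact: filter_uniq.
by move=> a; rewrite mem_filter; have [/pl->|//] := boolP (a \in msupp p).
Qed.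

Lemma mliftD h p q : mlift h (p + q) = mlift h p + mlift h q.
Proof.
pose l := undup (msupp p ++ msupp q).
have lu : uniq l by apply: undup_uniq.
rewrite !(mlift_sub _ lu) => [|a|a|a].
- by rewrite -big_split; apply: eq_bigr => a _; rewrite mcoeffD scalerDl.
- by rewrite mem_undup mem_cat => ->; rewrite orbT.
- by rewrite mem_undup mem_cat => ->.
- by move=> /msuppD_le; rewrite mem_undup.
Qed.

Lemma mlift0 h : mlift h 0 = 0.
Proof. by rewrite /mlift msupp0 big_nil. Qed.

Lemma mliftZX h c a : mlift h (c *: 'X_[a]) = c *: h a.
Proof.
rewrite (@mlift_sub _ _ [:: a]) => [||b /msuppZ_le]; last by rewrite msuppX.
  by rewrite big_seq1 mcoeffZ mcoeffX eqxx mulr1.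
by [].
Qed.

Implicit Type g : 'X_{1..n} * nat -> {mpoly k[r]}.

(** The k-linear extension of [g] from the bimonomials [x^a t^i] to all polynomials. *)
Definition plift g F : {mpoly k[r]} := \sum_(i < size F) mlift (fun a => g (a, nat_of_ord i)) F`_i.

Lemma plift_widen g F N : (size F <= N)%N ->
  plift g F = \sum_(i < N) mlift (fun a => g (a, nat_of_ord i)) F`_i.
Proof.
move=> sN; rewrite -(subnKC sN) big_split_ord /= [X in _ + X]big1 ?addr0 //.
by move=> i _; rewrite nth_default ?leq_addr // mlift0.
Qed.

Lemma pliftD g F G : plift g (F + G) = plift g F + plift g G.
Proof.
pose N := maxn (size F) (size G).
rewrite !(@plift_widen _ _ N) ?leq_maxl ?leq_maxr ?size_polyD //.
by rewrite -big_split; apply: eq_bigr => i _; rewrite coefD mliftD.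
Qed.

Lemma plift0 g : plift g 0 = 0.
Proof. by rewrite /plift size_poly0 big_ord0. Qed.

Lemma plift_bimonomial g c s : plift g (bimonomial c s) = c *: g s.
Proof.
rewrite (@plift_widen _ _ s.2.+1); last first.
  by rewrite (leq_trans (size_scale_leq _ _)) // size_polyXn.
rewrite (bigD1 ord_max) //= big1 ?addr0 => [|i /negPf ni].
  by rewrite coefZ coefXn eqxx mulr1 mliftZX; case: s.
by rewrite coefZ coefXn -val_eqE /= in ni *; rewrite ni mulr0 mlift0.
Qed.

End BigradedPolynomials.

(** * The ring morphism attached to a fiber face *)

Section FaceMorphism.
Variables (k : fieldType) (n r : nat) (S Fc : set ('X_{1..n} * nat)).
Variable theta : 'X_{1..n} * nat -> 'X_{1..r}.
Hypothesis Fc_face : fiber_face S Fc.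
Hypothesis S0 : forall a, S (a, 0%N).
Hypothesis theta0 : theta (zerox n) = 0%MM.
Hypothesis thetaD : forall s t, theta (addx s t) = (theta s + theta t)%MM.
Implicit Types (F G : {poly {mpoly k[n]}}).

(** Two maps in one: monomials outside the face are killed, and those of the face are sent along the
    additive map [theta]. *)
Definition face_exp s : {mpoly k[r]} := if `[< Fc s >] then 'X_[theta s] else 0.

Definition face_morph F := plift face_exp F.

(** The face property of [Fc] in [S] says that the killed monomials span a prime ideal of [k[S]];
    hence the restriction to polynomials supported in [S]. *)
Lemma face_morphM F G : supported S F -> supported S G ->
  face_morph (F * G) = face_morph F * face_morph G.
Proof.
move=> SF SG; rewrite /face_morph; move: F SF; apply: supported_ind => [|F1 F2 h1 h2|c s c0 Ss].
- by rewrite mul0r plift0 mul0r.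
- by rewrite mulrDl !pliftD h1 h2 mulrDl.
move: G SG; apply: supported_ind => [|G1 G2 h1 h2|d t d0 St].
- by rewrite mulr0 plift0 mulr0.
- by rewrite mulrDr !pliftD h1 h2 mulrDr.
rewrite bimonomialM !plift_bimonomial /face_exp.
have FD := ffaceD Fc_face Ss St.
case: asboolP => [/FD[Fs Ft]|nF].
  by rewrite !asboolT // thetaD mpolyXD -scalerAl -scalerAr scalerA.
case: asboolP => [Fs|]; last by rewrite !scaler0 mul0r.
case: asboolP => [Ft|]; last by rewrite !scaler0 mulr0.
by case: nF; apply/FD.
Qed.

Lemma face_morph1 : face_morph 1 = 1.
Proof.
have -> : 1 = bimonomial 1 (zerox n) :> {poly {mpoly k[n]}}.
  by rewrite /bimonomial mpolyX0 scale1r expr0 scale1r.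
rewrite /face_morph plift_bimonomial scale1r /face_exp asboolT ?theta0 ?mpolyX0 //.
exact: fface0 Fc_face.
Qed.

Lemma face_morphN F : face_morph (- F) = - face_morph F.
Proof. by apply/eqP; rewrite -addr_eq0 -pliftD addNr plift0. Qed.

Lemma irrelevant_ideal_coef0 (f : {mpoly k[n]}) a :
  irrelevant_ideal f -> a \in msupp f -> a <> 0%MM.
Proof.
rewrite /irrelevant_ideal.
have -> : [set 'X_i | i in [set: 'I_n]] =
    [set 'X_[m] | m in [set U_(i)%MM | i in [set: 'I_n]]] :> set {mpoly k[n]}.
  by rewrite image_comp.
rewrite ideal_gen_monomials => h /h[_ [i _ <-]] ia a0.
by move: ia; rewrite a0 lep1mP mnm0E.
Qed.

(** The monomials of [f] are nonzero of height 0, and a fiber face contains none of these. *)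
Lemma face_morph_irrelevant (f : {mpoly k[n]}) : irrelevant_ideal f -> face_morph f%:P = 0.
Proof.
move=> hf.
have : supported [set s | s.2 = 0%N /\ s.1 <> 0%MM] f%:P.
  move=> [a [|i]] /=; rewrite coefC //=; last by rewrite msupp0.
  by move=> /(irrelevant_ideal_coef0 hf).
rewrite /face_morph; move: f%:P; apply: supported_ind => [|F G hF hG|c s c0 [s0 s1]].
- exact: plift0.
- by rewrite pliftD hF hG addr0.
rewrite plift_bimonomial /face_exp asboolF ?scaler0 // => Fs.
have : (0 < s.2)%N by apply: fface_gt0 Fc_face S0 Fs _ => e; rewrite e in s1.
by rewrite s0.
Qed.

Variable I : set {mpoly k[n]}.
Hypothesis I_S : forall m f, symbolic_power I m f <-> forall a, a \in msupp f -> S (a, m).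

Lemma Rees_supported (x : symbolic_Rees I) : supported S (Rees_poly x).
Proof.
case: x => F /asboolP hF [a i] /= ai; exact: (I_S _ _).1 (hF i) a ai.
Qed.

Definition Rees_morph (x : symbolic_Rees I) := face_morph (Rees_poly x).

Lemma Rees_morph_is_zmod_morphism : zmod_morphism Rees_morph.
Proof.
move=> x y; rewrite /Rees_morph -face_morphN.
have -> : Rees_poly (x - y) = Rees_poly x - Rees_poly y by [].
exact: pliftD.
Qed.

Lemma Rees_morph_is_monoid_morphism : monoid_morphism Rees_morph.
Proof.
split=> [|x y]; rewrite /Rees_morph; first exact: face_morph1.
by rewrite -face_morphM //; apply: Rees_supported.
Qed.

Definition Rees_rmorph : {rmorphism symbolic_Rees I -> {mpoly k[r]}} :=
  HB.pack Rees_morph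
    (GRing.isZmodMorphism.Build _ _ Rees_morph Rees_morph_is_zmod_morphism)
    (GRing.isMonoidMorphism.Build _ _ Rees_morph Rees_morph_is_monoid_morphism).

Lemma Rees_rmorph_fiber (x : symbolic_Rees I) : x \in @in_fiber_ideal k n I -> Rees_rmorph x = 0.
Proof.
move=> /asboolP[s hs ->]; rewrite rmorph_sum big_seq big1 // => q /hs[_ [f hf e]].
rewrite rmorphM; have -> : Rees_rmorph q.2 = 0 by rewrite -(face_morph_irrelevant hf) -e.
by rewrite mulr0.
Qed.

End FaceMorphism.

Section Coordinates.
Variable n : nat.
Implicit Types s t : 'X_{1..n} * nat.

Definition crd s (i : 'I_(n + 1)) : nat :=
  match fintype.split i with inl l => s.1 l | inr _ => s.2 end.

Lemma crd0 i : crd (zerox n) i = 0%N.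
Proof. by rewrite /crd; case: fintype.split => // l; rewrite mnm0E. Qed.

Lemma crdD s t i : crd (addx s t) i = (crd s i + crd t i)%N.
Proof. by rewrite /crd; case: fintype.split => // l; rewrite mnmDE. Qed.

Lemma crdM s m i : crd (mulx s m) i = (crd s i * m)%N.
Proof. by rewrite /crd; case: fintype.split => // l; rewrite mulmnE. Qed.

Lemma crd_sum (J : Type) (r : seq J) (f : J -> 'X_{1..n} * nat) i :
  crd (\big[@addx n/zerox n]_(j <- r) f j) i = (\sum_(j <- r) crd (f j) i)%N.
Proof. by elim/big_rec2: _ => [|j x y _ <-]; rewrite ?crd0 ?crdD. Qed.

Lemma hv_crd (R : realFieldType) s i : hv s 0 i = (crd s i)%:R :> R.
Proof.
rewrite /crd; case: (fintype.split_ordP i) => l ->.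
  by rewrite homvL mxE.
by rewrite homvR.
Qed.

Lemma lin_indep_minor (K : fieldType) d m (x : 'I_m -> 'rV[K]_d) : lin_indep x ->
  exists rho : 'I_m -> 'I_d, \matrix_(i, j) x i 0 (rho j) \in unitmx.
Proof.
move=> /lin_indepP fr.
have rf : row_full (\matrix_i x i)^T by rewrite /row_full mxrank_tr.
exists (fullrankfun rf); rewrite -unitmx_tr.
suff -> : (\matrix_(i, j) x i 0 (fullrankfun rf j))^T = rowsub (fullrankfun rf) (\matrix_i x i)^T.
  exact: fullrowsub_unit.
by apply/matrixP => i j; rewrite !mxE.
Qed.

End Coordinates.

(** * Chains of primes in the fiber ring versus independent exponents in a fiber face *)

Section FiberChains.
Variables (R : realFieldType) (k : fieldType) (n : nat).
Variables (I : set {mpoly k[n]}) (S : set ('X_{1..n} * nat)).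
Hypothesis I_S : forall m f, symbolic_power I m f <-> forall a, a \in msupp f -> S (a, m).
Hypothesis S_submonoid : submonoid S.
Hypothesis S0 : forall a, S (a, 0%N).

Let Q := symbolic_fiber I.
Let pi (x : symbolic_Rees I) : Q :=
  \pi_({ideal_quot (@in_fiber_ideal k n I : idealr (symbolic_Rees I))}) x.

Lemma Rees_lift (F : {poly {mpoly k[n]}}) : supported S F ->
  exists x : symbolic_Rees I, Rees_poly x = F.
Proof.
move=> SF.
have FI : F \in in_symbolic_Rees I.
  by apply/asboolP => i; apply/I_S => a; apply: (SF (a, i)).
by exists (SymbolicRees FI).
Qed.

Definition is_chain m (c : nat -> prime_idealr Q) := forall i, (i < m)%N ->
  {subset c i <= c i.+1} /\ ~ {subset c i.+1 <= c i}.

Lemma fiber_face_chain Fc m (s : 'I_m -> 'X_{1..n} * nat) :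
    fiber_face S Fc -> (forall i, Fc (s i)) ->
    lin_indep (fun i => hv (s i) : 'rV[R]_(n + 1)) ->
  exists c, is_chain m c.
Proof.
move=> FF Fs li.
have [rho minor] := lin_indep_minor li.
pose trunc (j : nat) (u : 'X_{1..m}) : 'X_{1..m} :=
  [multinom if (j <= i)%N then u i else 0%N | i < m].
(* The [m] coordinates of the invertible minor, with the variables of index below [j] set to 1. *)
pose theta (j : nat) t : 'X_{1..m} :=
  [multinom if (j <= i)%N then crd t (rho i) else 0%N | i < m].
have th0 j : theta j (zerox n) = 0%MM.
  by apply/mnmP => i; rewrite mnmE crd0 mnm0E; case: ifP.
have thD j t t' : theta j (addx t t') = (theta j t + theta j t')%MM.
  by apply/mnmP => i; rewrite mnmDE !mnmE crdD; case: ifP.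
pose g j := Rees_rmorph FF (th0 j) (thD j) I_S.
have gE j x : g j x = face_morph Fc (theta j) (Rees_poly x) by [].
have /choice[c hc] : forall j : nat,
    exists p : prime_idealr Q, forall x, (pi x \in p) = (g j x == 0).
  by move=> j; apply: (quot_prime (g := g j)) => x; exact: (Rees_rmorph_fiber FF S0).
exists c => j jm; split.
  move=> z; rewrite -[z](reprK) ![_ \in c _]hc => /eqP gz.
  (* Setting variable [j] to 1 turns [g j] into [g j.+1], so the kernels increase. *)
  suff -> : g j.+1 (repr z) = mlift (fun u => 'X_[trunc j.+1 u]) (g j (repr z)).
    by rewrite gz mlift0.
  have Sz : supported S (Rees_poly (repr z : symbolic_Rees I)) by apply: Rees_supported.
  rewrite !gE; move: (Rees_poly _) Sz.
  apply: supported_ind => [|F G hF hG|a t a0 St].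
  - by rewrite /face_morph !plift0 mlift0.
  - by rewrite /face_morph !pliftD mliftD; congr (_ + _).
  rewrite /face_morph !plift_bimonomial /face_exp; case: asboolP => _.
    rewrite mliftZX; congr (_ *: 'X_[_]); apply/mnmP => i; rewrite !mnmE.
    by case: ltnP => // ji; rewrite ltnW.
  by rewrite !scaler0 mlift0.
(* Strictness: [a] and [b] are sought in the face whose coordinates [rho i] agree except for
   [i = j0]; the binomial of [a] and [b] is then killed by [g j.+1] but not by [g j]. Row [j0] of
   the adjugate combines the rows of [B] into [\det B] times a unit vector; the positive parts of
   its integer weights give [a], the negative parts give [b]. *)
pose B : 'M[int]_m := \matrix_(l, i) (crd (s l) (rho i))%:Z.
have detB : \det B != 0.
  have : \det (map_mx (intr : int -> R) B) != 0.
    move: minor; rewrite unitmxE unitfE; congr (\det _ != 0).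
    by apply/matrixP => l i; rewrite [LHS]mxE hv_crd !mxE.
  by rewrite det_map_mx intr_eq0.
pose j0 := Ordinal jm.
pose zp (z : int) : nat := if z is Posz l then l else 0%N.
pose zn (z : int) : nat := if z is Negz l then l.+1 else 0%N.
have zE z : z = (zp z)%:Z - (zn z)%:Z by case: z => l; rewrite /= ?subr0 ?sub0r // NegzE.
pose a := \big[@addx n/zerox n]_(l <- enum 'I_m) mulx (s l) (zp (\adj B j0 l)).
pose b := \big[@addx n/zerox n]_(l <- enum 'I_m) mulx (s l) (zn (\adj B j0 l)).
have Fbig (f : 'I_m -> nat) : Fc (\big[@addx n/zerox n]_(l <- enum 'I_m) mulx (s l) (f l)).
  elim/big_ind: _ => [|t t' Ft Ft'|l _]; first exact: (fface0 FF).
    by apply/(ffaceD FF) => //; apply: (fface_sub FF).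
  exact: (fface_mulx _ FF (Fs l)).
have abE i : (crd a (rho i))%:Z - (crd b (rho i))%:Z = \det B *+ (j0 == i).
  rewrite !crd_sum !big_enum /= !(big_morph Posz PoszD (erefl _)) -sumrB.
  have := congr1 (fun M : 'M_m => M j0 i) (mul_adj_mx B); rewrite !mxE => <-.
  apply: eq_bigr => l _; rewrite !crdM !PoszM -mulrBr -zE mulrC; congr (_ * _).
  by rewrite mxE.
have th_ab i : theta i a = theta i b <-> forall l : 'I_m, (i <= l)%N -> j0 != l.
  split=> [/mnmP e l il|h]; last first.
    apply/mnmP => l; rewrite !mnmE; case: ifP => // /h/negPf jl.
    by have /eqP := abE l; rewrite jl mulr0n subr_eq0 => /eqP[].
  have := abE l; have := e l; rewrite !mnmE il => ->; rewrite subrr.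
  by case: eqP => // _ /esym/eqP; rewrite mulr1n (negPf detB).
have Sa : S a by apply: (fface_sub FF); apply: Fbig.
have Sb : S b by apply: (fface_sub FF); apply: Fbig.
have [x xE] : exists x : symbolic_Rees I, Rees_poly x = bimonomial 1 a + bimonomial (- 1) b.
  apply: Rees_lift => t; rewrite mcoeff_msupp coefD mcoeffD !coef_bimonomial.
  have [<-//|_] := eqVneq a t; have [<-//|_] := eqVneq b t.
  by rewrite !mulr0 addr0 eqxx.
have gx i : g i x = 'X_[theta i a] - 'X_[theta i b].
  rewrite gE xE /face_morph pliftD !plift_bimonomial /face_exp !asboolT ?scaleN1r ?scale1r //.
    exact: Fbig.
  exact: Fbig.
move=> /(_ (pi x)); rewrite !hc !gx.
have -> : theta j.+1 a = theta j.+1 b.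
  by apply/th_ab => l; apply: contraTneq => <-; rewrite ltnn.
rewrite subrr eqxx => /(_ isT); rewrite subr_eq0 => /eqP.
move=> /(congr1 (mcoeff (theta j a))); rewrite !mcoeffX eqxx.
case: eqP => [/esym/th_ab/(_ j0 (leqnn _))|_ /eqP]; first by rewrite eqxx.
by rewrite oner_eq0.
Qed.

Lemma chain_fiber_face m c : is_chain m c ->
  exists2 Fc, fiber_face S Fc & exists s : 'I_m -> 'X_{1..n} * nat,
    (forall i, Fc (s i)) /\ lin_indep (fun i => hv (s i) : 'rV[R]_(n + 1)).
Proof.
move=> hc.
(* [mon t] is the monomial of exponent [t] in the Rees algebra; its value outside [S] is
   arbitrary. *)
have /choice[mon hmon] : forall t,
    exists x : symbolic_Rees I, S t -> Rees_poly x = bimonomial 1 t.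
  move=> t; have [St|nSt] := pselect (S t); last by exists 0.
  by have [x e] := Rees_lift (@supported_bimonomial k n S 1 t St); exists x.
have monM t t' : S t -> S t' -> mon (addx t t') = mon t * mon t'.
  move=> St St'; apply: val_inj.
  have -> : val (mon t * mon t') = Rees_poly (mon t) * Rees_poly (mon t') by [].
  have [_ SD] := S_submonoid.
  by rewrite /= !hmon //; [rewrite bimonomialM mulr1|apply: SD].
pose Fc : set ('X_{1..n} * nat) := [set t | S t /\ pi (mon t) \notin c 0%N].
have piM x y : pi (x * y) = pi x * pi y by exact: rmorphM.
have FF : fiber_face S Fc.
  split=> [t []//||t t' St St'|i [_]].
  - split; first by case: S_submonoid.
    have -> : mon (zerox n) = 1.
      apply: val_inj; rewrite /= hmon; last by case: S_submonoid.
      by rewrite /bimonomial mpolyX0 scale1r expr0 scale1r.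
    by rewrite [pi 1](rmorph1 _) idealr1.
  - rewrite /Fc /= monM // piM prime_idealrM negb_or.
    split=> [[_ /andP[]]//|[[_ ->] [_ ->]]]; split=> //.
    by have [_ SD] := S_submonoid; apply: SD.
  - suff -> : pi (mon (unitx i)) = 0 by rewrite rpred0.
    suff : mon (unitx i) - 0 \in @in_fiber_ideal k n I.
      rewrite Quotient.idealrBE => /eqP h.
      by transitivity (pi 0); [exact: h|exact: rmorph0].
    rewrite subr0 /in_fiber_ideal unfold_in; apply/asboolT.
    apply: ideal_genP; exists 'X_i; last first.
      by rewrite (hmon (unitx i) (S0 _)) /bimonomial scale1r expr0 alg_polyC.
    by apply: ideal_genP; exists i.
pose L q := exists s : 'I_q -> 'X_{1..n} * nat,
  (forall i, Fc (s i)) /\ lin_indep (fun i => hv (s i) : 'rV[R]_(n + 1)).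
have exL : exists q, `[< L q >].
  by exists 0%N; apply/asboolP; exists (fun=> zerox n); split=> [[]//|w _ []].
have boundL q : `[< L q >] -> (q <= n + 1)%N.
  by move=> /asboolP[s [_ /lin_indepP/eqP <-]]; apply: rank_leq_col.
(* [r] is the rank of [Fc]; maximality makes the [s i] span it. The case [m <= r] is the claim, and
   [r < m] is refuted below. *)
have [r /asboolP[s [Fs li]] rmax] := ex_maxnP exL boundL.
have [mr|rm] := leqP m r.
  exists Fc => //; exists (s \o widen_ord mr); split=> [i|]; first exact: Fs.
  apply: (lin_indep_comp (f := widen_ord mr) _ li) => i j /(congr1 val) /= e.
  exact: val_inj.
exfalso.
have span t : Fc t -> exists w : 'I_r -> R, hv t = \sum_i w i *: hv (s i) :> 'rV[R]_(n + 1).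
  move=> Ft; apply: contrapT => nw; suff /asboolP/rmax : L r.+1 by rewrite ltnn.
  exists (fun i => if unlift ord0 i is Some j then s j else t); split=> [i|w].
    by case: (unlift ord0 i) => [j|]; [apply: Fs|].
  rewrite big_ord_recl unlift_none; under eq_bigr do rewrite liftK.
  move=> e; have w0 : w ord0 = 0.
    apply: contrapT => /eqP w0; apply: nw; exists (fun i => - ((w ord0)^-1 * w (lift ord0 i))).
    move/eqP: e; rewrite addr_eq0 => /eqP e.
    rewrite -[LHS](scalerK w0) e scalerN scaler_sumr -sumrN.
    by apply: eq_bigr => i _; rewrite scaleNr scalerA.
  move: e; rewrite w0 scale0r add0r => /li h i.
  by case: (unliftP ord0 i) => [j|] ->.
have [rho minor] := lin_indep_minor li.
pose theta t : 'X_{1..r} := [multinom crd t (rho i) | i < r].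
have th0 : theta (zerox n) = 0%MM by apply/mnmP => i; rewrite mnmE crd0 mnm0E.
have thD t t' : theta (addx t t') = (theta t + theta t')%MM.
  by apply/mnmP => i; rewrite mnmDE !mnmE crdD.
(* Elements of [Fc] are combinations of the [s i], and the invertible minor recovers the weights
   from the coordinates [rho j]. Thus [g] identifies [k[Fc]] with a subring of a polynomial ring in
   [r] variables. *)
have th_inj t t' : Fc t -> Fc t' -> theta t = theta t' -> t = t'.
  move=> /span[w e] /span[w' e'] /mnmP tt; apply: (@hv_inj R).
  have wz : (\row_i (w i - w' i)) *m \matrix_(i, j) hv (s i) 0 (rho j) = 0 :> 'rV[R]_r.
    apply/rowP => j; rewrite mxE [RHS]mxE.
    transitivity ((hv t - hv t' : 'rV[R]_(n + 1)) 0 (rho j)).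
      rewrite e e' -sumrB summxE; apply: eq_bigr => i _.
      by rewrite [X in X * _]mxE [X in _ * X]mxE -scalerBl [RHS]mxE.
    rewrite mxE [X in _ + X]mxE !hv_crd; have := tt j; rewrite !mnmE => ->.
    by rewrite subrr.
  have {}wz i : w i = w' i.
    apply/eqP; rewrite -subr_eq0.
    move: wz => /(congr1 (mulmx^~ (invmx (\matrix_(i, j) hv (s i) 0 (rho j))))).
    by rewrite /= mulmxK // mul0mx => /rowP/(_ i); rewrite !mxE => ->.
  by rewrite e e'; apply: eq_bigr => i _; rewrite wz.
pose g := Rees_rmorph FF th0 thD I_S.
have gE x : g x = face_morph Fc theta (Rees_poly x) by [].
have coefE F t : Fc t -> supported S F -> (face_morph Fc theta F)@_(theta t) = F`_t.2@_t.1.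
  move=> Ft; move: F; apply: supported_ind => [|F G hF hG|a t' a0 St'].
  - by rewrite /face_morph plift0 coef0 !mcoeff0.
  - by rewrite /face_morph pliftD coefD !mcoeffD; congr (_ + _).
  rewrite coef_bimonomial /face_morph plift_bimonomial mcoeffZ /face_exp; congr (_ * _).
  case: asboolP => [Ft'|nFt']; last first.
    by rewrite mcoeff0; have [e|//] := eqVneq t' t; case: nFt'; rewrite e.
  rewrite mcoeffX; have [->|ne] := eqVneq t' t; first by rewrite eqxx.
  by case: eqP => // /(th_inj _ _ Ft' Ft)/eqP; rewrite (negPf ne).
have /choice[cst hcst] : forall a : k,
    exists x : symbolic_Rees I, Rees_poly x = bimonomial a (zerox n).
  move=> a; apply: Rees_lift; apply: (@supported_bimonomial k n S).
  by case: S_submonoid.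
(* By injectivity of [theta] no monomials of [Fc] cancel, so an element of the kernel is supported
   outside [Fc], on monomials that lie in [c 0] by definition of [Fc]. *)
have gker x : g x = 0 -> pi x \in c 0%N.
  move=> gx; have Sx : supported S (Rees_poly x) by apply: Rees_supported.
  have : supported [set t | S t /\ ~ Fc t] (Rees_poly x).
    move=> t tx; split=> [|Ft]; first exact: Sx.
    by move: tx; rewrite mcoeff_msupp -coefE // -gE gx mcoeff0 eqxx.
  suff H : forall F, supported [set t | S t /\ ~ Fc t] F ->
      exists y : symbolic_Rees I, Rees_poly y = F /\ pi y \in c 0%N.
    by move=> /H[y [/val_inj-> ]].
  apply: supported_ind => [|F G [y [<- yc]] [z [<- zc]]|a t a0 [St nFt]].
  - by exists 0; split=> //; rewrite [pi 0](rmorph0 _) rpred0.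
  - by exists (y + z); split=> //; rewrite [pi (y + z)](rmorphD _) rpredD.
  exists (cst a * mon t); split.
    have -> : Rees_poly (cst a * mon t) = Rees_poly (cst a) * Rees_poly (mon t) by [].
    by rewrite hcst hmon // bimonomialM mulr1 add0x.
  rewrite piM; apply: idealMr; apply/negPn/negP => h; apply: nFt.
  by split.
have /choice[f hf] : forall i, exists x, (i < m)%N -> pi x \in c i.+1 /\ pi x \notin c i.
  move=> i; have [im|] := boolP (i < m)%N; last by exists 0.
  have [_ nsub] := hc i im; apply: contrapT => h; apply: nsub => z zc.
  apply: contraT => zn; case: h; exists (repr z) => _.
  by rewrite /pi reprK.
have [N [c' [[e0 c0] csum]]] := mpoly_dependent (fun i : 'I_m => g (f i)) rm.
(* The relation among the [g (f i)], lifted to the Rees algebra: it lies in [c 0] by [gker], against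
   [chain_independent]. *)
pose X := \sum_e cst (c' e) * \prod_(i < m) f i ^+ e i.
have gX : g X = 0.
  rewrite -[RHS]csum rmorph_sum; apply: eq_bigr => e _.
  rewrite rmorphM rmorph_prod gE hcst /face_morph plift_bimonomial /face_exp asboolT; last first.
    exact: (fface0 FF).
  rewrite th0 mpolyX0 -scalerAl mul1r; congr (_ *: _).
  by apply: eq_bigr => i _; rewrite rmorphXn.
have := gker X gX.
pose ex (e : {ffun 'I_m -> 'I_N}) (i : nat) : nat :=
  oapp (fun j : 'I_m => nat_of_ord (e j)) 0%N (insub i).
have exE (e : {ffun 'I_m -> 'I_N}) (i : 'I_m) : ex e i = e i by rewrite /ex valK.
suff : pi X \notin c 0%N by move=> /negPf->.
have -> : pi X = \sum_(e | c' e != 0) pi (cst (c' e)) * \prod_(i < m) pi (f i) ^+ ex e i.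
  rewrite [pi X](rmorph_sum _) (bigID (fun e => c' e != 0)) /= [X in _ + X]big1 ?addr0.
    apply: eq_bigr => e _; rewrite rmorphM rmorph_prod; congr (_ * _).
    by apply: eq_bigr => i _; rewrite rmorphXn exE.
  move=> e /negPn/eqP ce; suff -> : cst (c' e) = 0 by rewrite mul0r rmorph0.
  by apply: val_inj; rewrite /= hcst ce /bimonomial !scale0r.
apply: (chain_independent (f := fun i => pi (f i))) => [i im|e p ce|e e' _ _ ee|].
- by have [sub _] := hc i im; have [h1 h2] := hf i im.
(* Nonzero constants are units, hence lie in no prime. *)
- apply/negP => h; have : pi (cst (c' e)^-1 * cst (c' e)) \in p by rewrite piM; apply: idealMr.
  have -> : cst (c' e)^-1 * cst (c' e) = 1.
    apply: val_inj.
    have -> : val (cst (c' e)^-1 * cst (c' e)) =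
      Rees_poly (cst (c' e)^-1) * Rees_poly (cst (c' e)) by [].
    rewrite !hcst bimonomialM mulVf // add0x.
    by rewrite /bimonomial mpolyX0 scale1r expr0 scale1r.
  by rewrite [pi 1](rmorph1 _) idealr1.
- by apply/ffunP => i; apply: val_inj; rewrite /= -!exE; apply: ee.
- by exists e0.
Qed.

End FiberChains.

(** Both sides are suprema, compared member by member: chains of length [m] against families of [m]
    affinely independent points, which [aff_dim] counts as dimension [m - 1]. *)
Theorem corollary4p5 (R : realType) (k : fieldType) (n : nat)
    (I : set {mpoly k[n]}) :
  monomial_ideal I ->
  symbolic_analytic_spread R I = (mdc (symbolic_polyhedron R I) + 1)%E.
Proof.
move=> [M ->]; rewrite ideal_gen_monomials; set E := [set a | _].
have Eup : upset E by move=> a b [g Mg ga] ab; exists g => //; apply: lepm_trans ab.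
rewrite symbolic_polyhedron_monomials //; set J : set {mpoly k[n]} := monomials_in E.
pose S := rees_family (@maxAss_exps k n E).
have J_S m f : symbolic_power J m f <-> forall a, a \in msupp f -> S (a, m).
  exact: symbolic_power_monomials.
have exps_up W := maxAss_exps_upset (k := k) Eup W.
have SS : submonoid S by apply: rees_family_submonoid.
have S0 a : S (a, 0%N) by apply: rees_family0.
set P := family_polyhedron R _.
apply/eqP; rewrite eq_le; apply/andP; split.
  apply: ge_ereal_sup => _ [m [c hc] <-].
  have [Fc FF [s [Fs li]]] := chain_fiber_face R J_S SS S0 hc.
  have -> : (m%:R%:E = (m%:R - 1)%:E + 1 :> \bar R)%E by rewrite -EFinD subrK.
  (* A chain of length 0 is matched with the empty face, of dimension -1, cut out by the functional
     0 at level -1. *)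
  apply: leeD2r; have [m0|m0] := posnP m.
    apply: (@le_trans _ _ (aff_dim (set0 : set 'rV[R]_n))).
      apply: ereal_sup_ubound; exists m => //.
      by rewrite m0; exists (fun=> 0); split=> [[]//|w _ _ []].
    apply: ereal_sup_ubound; exists set0 => //; split; last exact: compact0.
    exists 0, (-1); split=> [v _|].
      by rewrite big1 ?lerN10 // => i _; rewrite mxE mul0r.
    apply/seteqP; split=> v //= [_]; rewrite big1 => [/eqP|i _]; last by rewrite mxE mul0r.
    by rewrite eq_sym oppr_eq0 oner_eq0.
  have [G [fG cG] [x [Gx ai]]] := fiber_face_compact_face exps_up m0 FF Fs li.
  apply: (@le_trans _ _ (aff_dim G)); last by apply: ereal_sup_ubound; exists G.
  by apply: ereal_sup_ubound; exists m => //; exists x.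
rewrite -leeBrDr //; apply: ge_ereal_sup => _ [G [fG cG] <-].
apply: ge_ereal_sup => _ [m [x [Gx ai]] <-].
have [Fc FF [s [Fs li]]] := compact_face_fiber_face exps_up fG cG Gx ai.
have [c hc] := fiber_face_chain J_S S0 FF Fs li.
rewrite leeBrDr // -EFinD subrK; apply: ereal_sup_ubound; exists m => //.
by exists c.
Qed.
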